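(* Let $X$ be a finite $f$-spindle, where $X=X_0\sqcup\{b\}$ and $f\colon X_0\to X_0$. Then $$\widetilde H^N_0(X)\cong\mathbb{Z}^{\mathrm{orb}(f)},\qquad H^N_1(X)\cong\mathbb{Z}^{(\mathrm{orb}(f)-1)|X_0|+2\,\mathrm{orb}(f)}\oplus\mathbb{Z}_\ell^{\mathrm{init}(f)},$$ and for every $n\geqslant 2$ $$H^N_n(X)\cong\left(\mathbb{Z}^{(\mathrm{orb}(f)-1)|X|^2+|X|}\oplus\mathbb{Z}_\ell^{\mathrm{init}(f)|X|}\right)^{\oplus(|X|-1)^{n-2}}.$$ In particular, $H^N_{n+1}(X)\cong H^N_n(X)^{\oplus(|X|-1)}$ for $n\geqslant 2$.
   Context: A spindle $(X,\star)$ is a set $X$ with a binary operation $\star$ that is idempotent ($x\star x=x$) and self-distributive ($(x\star y)\star z=(x\star z)\star(y\star z)$). Its one-term distributive chain complex $C(X)$ has $C_n(X)=\mathbb{Z}X^{n+1}$, the free abelian group on sequences $(x_0,\dots,x_n)$ of elements of $X$ ($n\geqslant 0$), with $\partial_n=\sum_{i=0}^n(-1)^id^i$ where $d^0(x_0,\dots,x_n)=(x_1,\dots,x_n)$ and $d^i(x_0,\dots,x_n)=(x_0\star x_i,\dots,x_{i-1}\star x_i,x_{i+1},\dots,x_n)$ for $i\geqslant1$; the differential vanishes on $C_0(X)$. The degenerate subcomplex $C^D(X)$ is spanned by sequences with $x_i=x_{i+1}$ for some $0\leqslant i<n$. The normalized complex is $C^N(X)=C(X)/C^D(X)$, with homology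 $H^N(X)$. The augmented normalized complex has in addition $\mathbb{Z}$ in degree $-1$ with $\partial_0(x)=1$ for all $x\in X$; its homology is $\widetilde H^N(X)$. $f$-spindle: given a set $X$ with basepoint $b$, $X_0=X\setminus\{b\}$, and a function $f\colon X_0\to X_0$, the $f$-spindle is $X$ with the operation $b\star y=f(y)$ for $y\in X_0$, and $x\star y=y$ in all other cases (so $b\star b=b$). Let $\Gamma_f$ be the directed graph with vertex set $X_0$ and an edge $x\to f(x)$ for each $x\in X_0$. Then $\mathrm{orb}(f)$ is the number of connected components of $\Gamma_f$ (orbits of $f$), $\mathrm{init}(f)$ is the number of elements of $X_0$ not in the image of $f$, and $\ell$ is the greatest common divisor of the lengths of all directed cycles of $\Gamma_f$ ($\ell=0$ if there are no cycles). A cycle of length $1$ is a fixed point of $f$. $\mathbb{Z}_\ell=\mathbb{Z}/\ell\mathbb{Z}$. *)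

(* Defs.v *)
From HB Require Import structures.
From mathcomp Require Import all_boot all_order all_algebra.
From mathcomp Require Import generic_quotient ring_quotient zify.
From mathcomp Require Import boolp.

Set Implicit Arguments.
Unset Strict Implicit.
Unset Printing Implicit Defensive.

Import GRing.Theory.
Local Open Scope ring_scope.
Local Open Scope quotient_scope.

Definition zmod_iso (G H : zmodType) : Prop :=
  exists phi : {additive G -> H}, bijective phi.

Notation "G ≅ H" := (zmod_iso G H) (at level 70, no associativity).

(* Z/lZ for every l, unlike 'Z_l : it is Z for l = 0 and trivial for l = 1. *)
Definition Zmod (l : nat) : zmodType := {ideal_quot (dvdz l%:Z : {pred int})}.

Section QuotientLift.
Variables (A B : zmodType) (I : zmodClosed A) (g : {additive A -> B}).
Hypothesis gI : forall x, x \in I -> g x = 0.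

Definition quot_lift of (forall x, x \in I -> g x = 0) :=
  fun x : Quotient.quot I => g (repr x).

Lemma quot_liftE x : quot_lift gI (\pi x) = g x.
Proof.
apply/eqP; rewrite /quot_lift -subr_eq0 -raddfB gI //.
by rewrite Quotient.idealrBE reprK.
Qed.

Lemma quot_lift_is_zmod_morphism : zmod_morphism (quot_lift gI).
Proof.
move=> x y; rewrite -[x]reprK -[y]reprK.
by rewrite -[X in quot_lift _ X = _]raddfB !quot_liftE raddfB.
Qed.

HB.instance Definition _ :=
  GRing.isZmodMorphism.Build (Quotient.quot I) B (quot_lift gI)
    quot_lift_is_zmod_morphism.
End QuotientLift.

Section QuotientMap.
Variables (A B : zmodType) (I : zmodClosed A) (J : zmodClosed B).
Variable g : {additive A -> B}.
Hypothesis gIJ : forall x, x \in I -> g x \in J.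

Lemma pi_comp_eq0 x : x \in I -> (\pi_(Quotient.quot J) \o g) x = 0.
Proof.
move=> xI; apply/eqP.
by rewrite -(raddf0 \pi_(Quotient.quot J)) /= -Quotient.idealrBE subr0 gIJ.
Qed.

Definition quot_map : {additive Quotient.quot I -> Quotient.quot J} :=
  quot_lift pi_comp_eq0.

Lemma quot_mapE x : quot_map (\pi x) = \pi_(Quotient.quot J) (g x).
Proof. exact: quot_liftE. Qed.
End QuotientMap.

Section HomologyAt.
Variables (A B C : zmodType) (d1 : {additive A -> B}) (d0 : {additive B -> C}).

Definition ker_pred : {pred B} := fun z => d0 z == 0.

Lemma ker_zmod_closed : zmod_closed ker_pred.
Proof.
split=> [|x y]; rewrite !unfold_in ?raddf0 // => /eqP x0 /eqP y0.
by rewrite raddfB x0 y0 subrr.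
Qed.

HB.instance Definition _ := GRing.isZmodClosed.Build B ker_pred ker_zmod_closed.

Record cycles := Cycle { cycle_val :> B; _ : cycle_val \in ker_pred }.

HB.instance Definition _ := [isSub for cycle_val].
HB.instance Definition _ := [Choice of cycles by <:].
HB.instance Definition _ := [SubChoice_isSubZmodule of cycles by <:].

Definition boundaries : {pred cycles} :=
  fun z => `[< exists a, d1 a = cycle_val z >].

Lemma boundaries_zmod_closed : zmod_closed boundaries.
Proof.
split=> [|x y].
  by apply/asboolP; exists 0; rewrite !raddf0.
move=> /asboolP[a ax] /asboolP[b by_]; apply/asboolP; exists (a - b).
by rewrite raddfB ax by_ -[cycle_val (x - y)]/(val (x - y)) raddfB.
Qed.

HB.instance Definition _ :=
  GRing.isZmodClosed.Build cycles boundaries boundaries_zmod_closed.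

Definition homology_at : zmodType := Quotient.quot boundaries.
End HomologyAt.

Record chain_complex := ChainComplex {
  obj : nat -> zmodType;
  diff : forall n, {additive obj n.+1 -> obj n};
  diff_diff : forall n x, diff n (diff n.+1 x) = 0
}.

Definition homology (K : chain_complex) (n : nat) : zmodType :=
  match n with
  | 0 => homology_at (diff K 0) (\0 : {additive obj K 0 -> obj K 0})
  | m.+1 => homology_at (diff K m.+1) (diff K m)
  end.

(* The free abelian group on a finite set, as integer-valued functions. *)
Notation freeab T := {ffun T -> int}.

Section FreeAbelian.
Variable T : finType.

Definition gen (t : T) : freeab T := [ffun s => (s == t)%:R].

Definition extend (V : zmodType) (g : T -> V) (c : freeab T) : V :=
  \sum_t g t *~ c t.

Lemma extend_is_zmod_morphism (V : zmodType) (g : T -> V) : zmod_morphism (@extend V g).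
Proof.
move=> c d; rewrite /extend -sumrB; apply: eq_bigr => t _.
by rewrite !ffunE mulrzBr.
Qed.

HB.instance Definition _ (V : zmodType) (g : T -> V) :=
  GRing.isZmodMorphism.Build (freeab T) V (@extend V g)
    (@extend_is_zmod_morphism V g).

Lemma extend_gen (V : zmodType) (g : T -> V) t : extend g (gen t) = g t.
Proof.
rewrite /extend (bigD1 t) //= ffunE eqxx big1 ?addr0 // => s /negPf st.
by rewrite ffunE st.
Qed.

Lemma freeabE (c : freeab T) : c = \sum_t gen t *~ c t.
Proof.
apply/ffunP=> s; rewrite sum_ffunE (bigD1 s) //= big1 ?addr0 => [|t ts].
  by rewrite ffunMzE ffunE eqxx intz.
by rewrite ffunMzE ffunE eq_sym (negPf ts) mul0rz.
Qed.
End FreeAbelian.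

Lemma extend_extend (S T : finType) (V : zmodType) (g : S -> freeab T)
    (h : {additive freeab T -> V}) (c : freeab S) :
  h (extend g c) = extend (h \o g) c.
Proof. by rewrite raddf_sum; apply: eq_bigr => s _; rewrite raddfMz. Qed.

Record spindle (X : Type) := Spindle {
  star :> X -> X -> X;
  star_idem : idempotent_op star;
  star_distr : left_distributive star star
}.

Section NormalizedComplex.
Variables (X : finType) (S : spindle X).

(* For i = 0 no index is below i, so this drops the first entry. *)
Definition face n (i : 'I_n.+2) (t : n.+2.-tuple X) : n.+1.-tuple X :=
  [tuple if (k < i)%N then S (tnth t (lift i k)) (tnth t i)
         else tnth t (lift i k) | k < n.+1].

Local Notation chain n := (freeab (n.+1.-tuple X)).

Definition boundary n : {additive chain n.+1 -> chain n} :=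
  extend (fun t => \sum_(i < n.+2) gen (face i t) *~ (-1) ^+ i).

Definition degenerate n (t : n.+1.-tuple X) : bool :=
  [exists i : 'I_n, tnth t (widen_ord (leqnSn n) i) == tnth t (lift ord0 i)].

Definition degenerate_chain n : {pred chain n} :=
  fun c => c == \sum_(t | degenerate t) gen t *~ c t.

Lemma degenerate_chainP n (c : chain n) :
  reflect (forall t, ~~ degenerate t -> c t = 0) (c \in @degenerate_chain n).
Proof.
apply: (iffP eqP) => [-> t ndt | c0].
  rewrite sum_ffunE big1 // => s ds; rewrite ffunMzE ffunE.
  by case: eqP ndt => [->|_ _]; rewrite ?ds // mul0rz.
rewrite {1}[c]freeabE (bigID (@degenerate n)) /= [X in _ + X]big1 ?addr0 //.
by move=> t /c0 ->; rewrite mulr0z.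
Qed.

Lemma degenerate_chain_zmod_closed n : zmod_closed (@degenerate_chain n).
Proof.
split=> [|c d /degenerate_chainP c0 /degenerate_chainP d0];
  apply/degenerate_chainP=> t ndt; first by rewrite ffunE.
by rewrite !ffunE c0 // d0 // subrr.
Qed.

HB.instance Definition _ n :=
  GRing.isZmodClosed.Build (chain n) (@degenerate_chain n)
    (@degenerate_chain_zmod_closed n).

Lemma gen_degenerate n (t : n.+1.-tuple X) :
  degenerate t -> gen t \in @degenerate_chain n.
Proof.
move=> dt; apply/degenerate_chainP=> s; rewrite ffunE.
by case: eqP => [->|//]; rewrite dt.
Qed.

Lemma nth_face x0 n (i : 'I_n.+2) (t : n.+2.-tuple X) k : (k < n.+1)%N ->
  nth x0 (face i t) k =
    if (k < i)%N then S (nth x0 t k) (nth x0 t i) else nth x0 t k.+1.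
Proof.
move=> kn; rewrite -[k]/(nat_of_ord (Ordinal kn)) -tnth_nth tnth_mktuple.
rewrite !(tnth_nth x0) /= /bump.
by case: ltnP => ik; rewrite ?add0n.
Qed.

Lemma nth_tuple_eq x0 n (s t : n.-tuple X) :
  (forall k, (k < n)%N -> nth x0 s k = nth x0 t k) -> s = t.
Proof.
by move=> st; apply: eq_from_tnth => k; rewrite !(tnth_nth x0) st.
Qed.

Lemma face_face n (t : n.+3.-tuple X) (i j : 'I_n.+2)
    (i' j' : 'I_n.+3) : (i <= j)%N -> i' = i :> nat -> j' = j.+1 :> nat ->
  face j (face i' t) = face i (face j' t).
Proof.
move=> ij ii jj; have x0 := thead t; apply: (@nth_tuple_eq x0) => k kn.
have [jn i_n] := (ltn_ord j, ltn_ord i).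
rewrite !nth_face ?ii ?jj //; try lia.
case: (ltnP k i) => ki.
  have kj : (k < j)%N by lia.
  have kj1 : (k < j.+1)%N by lia.
  have ij1 : (i < j.+1)%N by lia.
  have ji : (j < i)%N = false by lia.
  by rewrite kj kj1 ij1 ji star_distr.
have k1i : (k.+1 < i)%N = false by lia.
have ji : (j < i)%N = false by lia.
by rewrite k1i ji ltnS; case: ltnP.
Qed.

Lemma boundary_gen n (t : n.+2.-tuple X) :
  boundary n (gen t) = \sum_(i < n.+2) gen (face i t) *~ (-1) ^+ i.
Proof. exact: extend_gen. Qed.

Lemma boundary_boundary n (c : chain n.+2) : boundary n (boundary n.+1 c) = 0.
Proof.
rewrite /= extend_extend /extend big1 // => t _ /=.
rewrite -[X in X *~ _]/(boundary n _) raddf_sum.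
under eq_bigr => i _ do rewrite raddfMz boundary_gen mulrz_suml.
rewrite pair_big (bigID (fun p : 'I_n.+3 * 'I_n.+2 => (p.1 <= p.2)%N)) /=.
pose h (p : 'I_n.+3 * 'I_n.+2) : 'I_n.+3 * 'I_n.+2 :=
  if (p.1 <= p.2)%N then (lift ord0 p.2, inord p.1)
  else (widen_ord (leqnSn _) p.2, inord p.1.-1).
have hK p : h (h p) = p.
  have := (ltn_ord p.1, ltn_ord p.2); rewrite /h => -[].
  case: p => i j /= ilt jlt; case: (leqP i j) => /= ij.
    rewrite ifF /bump; last by rewrite inordK; lia.
    by congr (_, _); apply: val_inj; rewrite /= /bump ?leq0n ?inordK; lia.
  rewrite ifT; last by rewrite inordK; lia.
  by congr (_, _); apply: val_inj; rewrite /= /bump ?leq0n ?inordK; lia.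
rewrite [X in _ + X](reindex_onto h h) /=; last by move=> p _; exact: hK.
rewrite [X in _ + X](eq_bigl (fun p : 'I_n.+3 * 'I_n.+2 => (p.1 <= p.2)%N));
  last first.
  move=> -[i j]; rewrite hK eqxx andbT /h /=.
  have [ilt jlt] := (ltn_ord i, ltn_ord j).
  by case: (leqP i j) => /= ij; rewrite ?inordK /bump; lia.
rewrite -big_split big1 ?mul0rz //= => -[i j] /= ij; rewrite /h ij /=.
have [ilt jlt] := (ltn_ord i, ltn_ord j).
have i_in : (inord i : 'I_n.+2) = i :> nat by rewrite inordK; lia.
rewrite (@face_face _ t (inord i) j i (lift ord0 j)) ?i_in //.
rewrite -!mulrzA /bump /= exprS mulN1r mulrN mulrNz [_ ^+ j * _]mulrC.
exact: subrr.
Qed.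

Lemma face_degenerate n (t : n.+2.-tuple X) (i j : 'I_n.+2) :
  j = i.+1 :> nat -> tnth t i = tnth t j -> face i t = face j t.
Proof.
have x0 := thead t; rewrite !(tnth_nth x0) => ji tij.
apply: (@nth_tuple_eq x0) => k kn; rewrite !nth_face // -tij ji.
have [ki|ik] := ltnP k i; first by rewrite ltnS ltnW.
rewrite ltnS; case: leqP => // ki.
have -> : k = i by lia.
by rewrite star_idem tij ji.
Qed.

Lemma degenerateP x0 n (t : n.+1.-tuple X) :
  reflect (exists2 k, (k < n)%N & nth x0 t k = nth x0 t k.+1) (degenerate t).
Proof.
apply: (iffP existsP) => [[k]|[k kn tk]].
  by rewrite !(tnth_nth x0) /= => /eqP; exists k.
by exists (Ordinal kn); rewrite !(tnth_nth x0) /= tk.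
Qed.

Lemma degenerate_face n (t : n.+2.-tuple X) (i : 'I_n.+2) (k : nat) x0 :
  (k < n.+1)%N -> nth x0 t k = nth x0 t k.+1 -> i != k :> nat ->
  i != k.+1 :> nat -> degenerate (face i t).
Proof.
move=> kn tk ik ik1; have il := ltn_ord i; apply/(degenerateP x0).
have [ki|ki] := ltnP k i.
  exists k; first by lia.
  rewrite !nth_face; try lia.
  by rewrite ki tk ifT //; lia.
exists k.-1; first by lia.
rewrite !nth_face; try lia.
by rewrite !ifF ?prednK //; lia.
Qed.

Lemma boundary_degenerate n (c : chain n.+1) :
  c \in @degenerate_chain n.+1 -> boundary n c \in @degenerate_chain n.
Proof.
move=> /eqP ->; rewrite raddf_sum rpred_sum // => t dt.
rewrite raddfMz rpredMz // boundary_gen.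
have x0 := thead t; have /(degenerateP x0)[k kn tk] := dt.
pose i : 'I_n.+2 := inord k; pose j : 'I_n.+2 := inord k.+1.
have ik : i = k :> nat by rewrite inordK //; lia.
have jk : j = k.+1 :> nat by rewrite inordK.
have ij : j != i by rewrite -val_eqE /= ik jk; lia.
rewrite (bigD1 i) //= (bigD1 j) //= addrA.
rewrite (@face_degenerate _ t i j) ?ik ?jk //; last first.
  by rewrite !(tnth_nth x0) ik jk.
rewrite ?jk ?ik exprS mulN1r mulrNz subrr add0r.
rewrite rpred_sum // => l /andP[li lj].
rewrite rpredMz //; apply/gen_degenerate/(@degenerate_face _ _ _ k x0) => //.
  by rewrite -ik val_eqE.
by rewrite -jk val_eqE.
Qed.

Definition normalized_chain n : zmodType := Quotient.quot (@degenerate_chain n).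

Definition normalized_boundary n :
    {additive normalized_chain n.+1 -> normalized_chain n} :=
  quot_map (@boundary_degenerate n).

Lemma normalized_boundary_boundary n x :
  normalized_boundary n (normalized_boundary n.+1 x) = 0.
Proof.
by rewrite -[x]reprK !quot_mapE boundary_boundary raddf0.
Qed.

Definition normalized_complex : chain_complex :=
  ChainComplex normalized_boundary_boundary.

Lemma degenerate0 (c : chain 0) : c \in @degenerate_chain 0 ->
  extend (fun=> 1 : int) c = 0.
Proof.
by move=> /eqP ->; rewrite big_pred0 ?raddf0 // => t; apply/existsP => -[[]].
Qed.

Definition augmentation : {additive normalized_chain 0 -> int} :=
  quot_lift degenerate0.

Lemma augmentationE (c : chain 0) :
  augmentation (\pi c) = extend (fun=> 1 : int) c.
Proof. exact: quot_liftE. Qed.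

Lemma augmentation_boundary x : augmentation (normalized_boundary 0 x) = 0.
Proof.
rewrite -[x]reprK quot_mapE augmentationE /= extend_extend.
rewrite /extend big1 // => t _ /=.
by rewrite raddf_sum !big_ord_recl big_ord0 /= !raddfMz /= !extend_gen mul0rz.
Qed.

(* Degrees are shifted by one: object 0 is the Z in degree -1. *)
Definition augmented_obj n : zmodType :=
  if n is m.+1 then normalized_chain m else int.

Definition augmented_diff n : {additive augmented_obj n.+1 -> augmented_obj n} :=
  match n with
  | 0 => augmentation
  | m.+1 => normalized_boundary m
  end.

Lemma augmented_diff_diff n x : augmented_diff n (augmented_diff n.+1 x) = 0.
Proof.
case: n x => [|n] x; first exact: augmentation_boundary.
exact: normalized_boundary_boundary.
Qed.

Definition augmented_normalized_complex : chain_complex :=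
  ChainComplex augmented_diff_diff.

Definition normalized_homology n : zmodType := homology normalized_complex n.

Definition reduced_normalized_homology n : zmodType :=
  homology augmented_normalized_complex n.+1.
End NormalizedComplex.

Section FSpindle.
Variables (X0 : Type) (f : X0 -> X0).

(* The basepoint b is None, so that X0 is the complement of b in option X0. *)
Definition fspindle_op (x y : option X0) : option X0 :=
  match x, y with
  | None, Some y0 => Some (f y0)
  | _, _ => y
  end.

Lemma fspindle_idem : idempotent_op fspindle_op.
Proof. by case. Qed.

Lemma fspindle_distr : left_distributive fspindle_op fspindle_op.
Proof. by move=> [x|] [y|] [z|]. Qed.

Definition fspindle : spindle (option X0) :=
  Spindle fspindle_idem fspindle_distr.
End FSpindle.

Section FunctionGraph.
Variables (X0 : finType) (f : X0 -> X0).

(* fcard f is not suitable here: it is meaningful only for injective f. *)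
Definition orb : nat := n_comp [rel x y | (f x == y) || (f y == x)] X0.

Definition init : nat := #|[pred x | x \notin codom f]|.

(* Cycles are simple, so they have at most #|X0| vertices. *)
Definition cycle_gcd : nat :=
  \big[gcdn/0%N]_(1 <= k < #|X0|.+1 |
                    [exists c : k.-tuple X0, ucycleb (frel f) c]) k.

Lemma orb_eq0 : orb = 0%N -> #|X0| = 0%N.
Proof.
move=> orb0; apply/eqP; rewrite -leqn0 leqNgt; apply/card_gt0P => -[x _].
pose e := [rel x y | (f x == y) || (f y == x)].
have sym_e : connect_sym e.
  by apply: sym_connect_sym => u v /=; rewrite orbC.
have /card0_eq/(_ (fingraph.root e x)) := orb0.
by rewrite !inE (roots_root sym_e).
Qed.

(* The ranks are nonnegative even when X0 is empty, where orb = 0. *)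
Lemma rank1_ge0 : 0 <= (orb%:Z - 1) * #|X0|%:Z + 2 * orb%:Z.
Proof. by case: (posnP orb) => [/[dup] /orb_eq0 -> ->|]; nia. Qed.

Lemma rank2_ge0 :
  0 <= (orb%:Z - 1) * #|{: option X0}|%:Z ^+ 2 + #|{: option X0}|%:Z.
Proof.
by rewrite card_option; case: (posnP orb) => [/[dup] /orb_eq0 -> ->|]; nia.
Qed.
End FunctionGraph.

(* Main.v *)
From HB Require Import structures.
Require Import Defs.
From mathcomp Require Import all_boot all_order all_algebra.
From mathcomp Require Import generic_quotient ring_quotient zify boolp.
Set Implicit Arguments.
Unset Strict Implicit.
Unset Printing Implicit Defensive.
Import GRing.Theory Num.Theory.
Local Open Scope ring_scope.
Local Open Scope quotient_scope.

(** Extend [f] to the basepoint by [f b = b].  Since [b ⋆ y = f y], while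
    [x ⋆ y = y] for [x <> b], most faces of a word are degenerate, and what
    survives is easiest to read through the homomorphisms out of the cokernel
    of the boundary.  Such a homomorphism is a cocycle: a function [G] on words
    that vanishes on words with two equal adjacent letters and on boundaries.

    The boundary of [b x w] says that [G (f x w) = G (x w) + increment G w]:
    for a fixed [w], walking along an edge of the graph of [f] adds a quantity
    that does not depend on the edge ([cocycle_step]).  So the values [G (x w)]
    are known from one value for each component and from the increments, and
    a walk around a cycle of length [k] shows that [k] kills the increment;
    hence so does the greatest common divisor [l] of the cycle lengths.  The
    increments are in turn combinations of elements [tors_gen y r], where [r]
    is shorter than [w] by one letter, and [tors_gen y r] vanishes when [y] is
    in the image of [f] ([altsum_tors_gen], [tors_gen_f]).  Therefore the
    cokernel of the boundary into degree [n >= 1] is generated by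
    - one element for each component and nondegenerate word of length [n];
    - one element of order dividing [l] for each vertex outside the image
      of [f] and nondegenerate word of length [n - 1].
    Two explicit cocycles, [free_cocycle] and [tors_cocycle], separate these
    generators, so the cokernel is the sum of a free group and of copies
    of [Z/l] on them ([fspindle_split_pos]).  The second cocycle multiplies the
    increment by a height, a function with [h (f x) = h x + 1] modulo [l].

    The homology in degree [n] is the kernel of the map that the boundary
    induces from this cokernel to the free group of chains of degree [n - 1].
    It contains all the torsion, and its rank follows by counting from the
    cokernels in degrees [n] and [n - 1] ([homology_split]).  There are
    [|X| * |X0| ^ (n - 1)] nondegenerate words of length [n], which gives the
    ranks and the exponents of [Z/l]. *)

(** * Kernels of integer matrices *)

Local Notation "A ^Q" := (map_mx (@intmul rat 1) A) (at level 8, format "A ^Q").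

Lemma ratmx_inj p q : injective (fun A : 'M[int]_(p, q) => A^Q).
Proof.
move=> A B /matrixP AB; apply/matrixP=> i j; have := AB i j.
by rewrite !mxE => /intr_inj.
Qed.

Lemma clear_denominators m (v : 'rV[rat]_m) :
  exists2 c : rat, c != 0 & exists w : 'rV[int]_m, c *: v = w^Q.
Proof.
pose d : int := \prod_j denq (v 0 j); exists d%:~R.
  by rewrite intr_eq0; apply/prodf_neq0 => j _; exact: denq_neq0.
exists (\row_j (numq (v 0 j) * \prod_(i | i != j) denq (v 0 i))).
apply/rowP=> j; rewrite !mxE intrM /d (bigD1 j) //= intrM.
rewrite mulrAC [X in X * _]mulrC; congr (_ * _).
by rewrite -[X in X * _]divq_num_den divfK // intr_eq0 denq_neq0.
Qed.

(** In Smith coordinates the kernel is spanned by the coordinate vectors of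
    the zero rows, hence is a direct summand. The last clause is over the
    rationals because the rank of the summand is read off there. *)
Lemma int_kernel_summand k m (D : 'M[int]_(k, m)) :
  exists (r : nat) (ret : 'M[int]_(k, r)) (inc : 'M[int]_(r, k)),
    [/\ inc *m D = 0, inc *m ret = 1%:M
      & forall v : 'rV[rat]_k, v *m D^Q = 0 -> v *m ret^Q *m inc^Q = v].
Proof.
have [L uL [R uR [d _ DE]]] := int_Smith_normal_form D.
set Dl := \matrix_(i, j) _ in DE.
pose J := [pred i : 'I_k | [forall j, Dl i j == 0]].
pose g : 'I_#|J| -> 'I_k := fun i => enum_val i.
exists #|J|, (colsub g L), (rowsub g (invmx L)); split.
- rewrite mul_rowsub_mx DE -mulmxA mulKmx //.
  apply/matrixP=> i j; rewrite !mxE big1 // => s _.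
  by have /forallP/(_ s)/eqP -> := enum_valP i; rewrite mul0r.
- rewrite mulmx_colsub mul_rowsub_mx mulVmx //.
  by apply/matrixP=> i j; rewrite !mxE (inj_eq enum_val_inj).
have unitQ n (A : 'M[int]_n) : A \in unitmx -> A^Q \in unitmx.
  move=> uA; rewrite unitmxE det_map_mx; apply: rmorph_unit.
  by rewrite -unitmxE.
have Dl_col (i i' : 'I_k) (j : 'I_m) : Dl i j != 0 -> Dl i' j != 0 -> i = i'.
  rewrite !mxE; have [e|] := i =P j :> nat; last by [].
  have [e' _ _|] := i' =P j :> nat; last by [].
  by apply: val_inj; rewrite /= e e'.
move=> v; rewrite DE !map_mxM mulmxA => /(canRL (mulmxK (unitQ _ _ uR))).
rewrite mul0mx => vD.
(* a nonzero diagonal entry forces the matching coordinate of v L to vanish *)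
have v0 i : i \notin J -> (v *m L^Q) 0 i = 0.
  rewrite inE negb_forall => /existsP[j ij].
  have /matrixP/(_ 0 j) := vD; rewrite mulmxA mxE (bigD1 i) //= big1 ?addr0.
    rewrite [X in _ = X]mxE => /eqP; rewrite mulf_eq0 => /orP[/eqP //|].
    by rewrite mxE intr_eq0 (negPf ij).
  move=> s si; rewrite [Dl^Q _ _]mxE.
  have [->|sj] := eqVneq (Dl s j) 0; first by rewrite mulr0.
  by rewrite (Dl_col _ _ _ sj ij) eqxx in si.
have -> : (colsub g L)^Q = colsub g L^Q by apply/matrixP=> a b; rewrite !mxE.
have -> : (rowsub g (invmx L))^Q = rowsub g (invmx L)^Q.
  by apply/matrixP=> a b; rewrite !mxE.
transitivity (v *m L^Q *m (invmx L)^Q); last first.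
  by rewrite -mulmxA -map_mxM mulmxV // map_mx1 mulmx1.
rewrite mulmx_colsub; apply/matrixP=> a b.
rewrite !mxE [RHS](bigID (mem J)) /= [X in _ = _ + X]big1 ?addr0.
  rewrite [RHS](big_enum_val (A := mem J)).
  by apply: eq_bigr => i _; rewrite !mxE.
by move=> i iJ; rewrite (ord1 a) v0 // mul0r.
Qed.

Lemma int_kernel_rank k m r (D : 'M[int]_(k, m)) (ret : 'M[int]_(k, r))
    (inc : 'M[int]_(r, k)) :
  inc *m D = 0 -> inc *m ret = 1%:M ->
  (forall v : 'rV[rat]_k, v *m D^Q = 0 -> v *m ret^Q *m inc^Q = v) ->
  (r + \rank D^Q = k)%N.
Proof.
move=> incD incK retK.
have ker_inc : (kermx D^Q == inc^Q)%MS.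
  apply/andP; split.
    by apply/rV_subP=> v /sub_kermxP/retK <-; exact: submxMl.
  by apply/sub_kermxP; rewrite -map_mxM incD map_mx0.
have rank_inc : \rank inc^Q = r.
  apply/eqP; rewrite eqn_leq rank_leq_row /=.
  rewrite -{1}(mxrank1 rat r) -(map_mx1 (@intmul rat 1)) -incK map_mxM.
  exact: mxrankM_maxl.
by rewrite -rank_inc -(eqmx_rank ker_inc) mxrank_ker subnK // rank_leq_row.
Qed.

(** A surjection [P] that kills the rows of [D], and whose kernel they span up
    to a bounded multiple, determines the rank of [D]. *)
Lemma rank_of_cokernel k m k' (D : 'M[int]_(k, m)) (P : 'M[int]_(m, k'))
    (S : 'M[int]_(k', m)) (mu : int) :
  D *m P = 0 -> S *m P = 1%:M -> mu != 0 ->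
  (forall v : 'rV_m, v *m P = 0 -> exists y : 'rV_k, y *m D = mu *: v) ->
  (\rank D^Q + k' = m)%N.
Proof.
move=> DP SP mu0 sat.
have rP : \rank P^Q = k'.
  apply/eqP; rewrite eqn_leq rank_leq_col /=.
  rewrite -{1}(mxrank1 rat k') -(map_mx1 (@intmul rat 1)) -SP map_mxM.
  exact: mxrankM_maxr.
have kerP : (kermx P^Q == D^Q)%MS.
  apply/andP; split; last by apply/sub_kermxP; rewrite -map_mxM DP map_mx0.
  apply/rV_subP => v /sub_kermxP vP; have [c c0 [w cw]] := clear_denominators v.
  have [|y yD] := sat w.
    by apply: ratmx_inj; rewrite map_mxM map_mx0 -cw -scalemxAl vP scaler0.
  have -> : v = (c^-1 * mu%:~R^-1) *: (y^Q *m D^Q).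
    rewrite -map_mxM yD map_mxZ -cw !scalerA.
    rewrite -[LHS]scale1r; congr (_ *: _).
    by rewrite mulrA /= divfK ?intr_eq0 // mulVf.
  by rewrite scalemx_sub // submxMl.
rewrite -(eqmx_rank kerP) mxrank_ker rP subnK // -rP.
exact: rank_leq_row.
Qed.

(** Here [P] is the projection onto the free part of the cokernel of [D], so
    the rank of [D] is [m - k'] and that of its kernel [k - (m - k')]. *)
Lemma int_kernel k m k' r (D : 'M[int]_(k, m)) (P : 'M[int]_(m, k'))
    (S : 'M[int]_(k', m)) (mu : int) :
  D *m P = 0 -> S *m P = 1%:M -> mu != 0 ->
  (forall v : 'rV_m, v *m P = 0 -> exists y : 'rV_k, y *m D = mu *: v) ->
  (r + m = k + k')%N ->
  exists (ret : 'M[int]_(k, r)) (inc : 'M[int]_(r, k)),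
    [/\ inc *m D = 0, inc *m ret = 1%:M
      & forall v : 'rV_k, v *m D = 0 -> v *m ret *m inc = v].
Proof.
move=> DP SP mu0 sat rE.
have [r' [ret [inc [incD incK retK]]]] := int_kernel_summand D.
have rD := int_kernel_rank incD incK retK.
have rP := rank_of_cokernel DP SP mu0 sat.
have -> : r = r' by lia.
exists ret, inc; split=> // v vD; apply: ratmx_inj.
by rewrite !map_mxM retK // -map_mxM vD map_mx0.
Qed.

(** * Homology of complexes with split cokernels *)

Lemma additive_bijective (G H : zmodType) (g : {additive G -> H}) :
  (forall x, g x = 0 -> x = 0) -> (forall y, exists x, g x = y) -> bijective g.
Proof.
move=> g0 /choice[h hK]; exists h => // x.
by apply/eqP; rewrite -subr_eq0; apply/eqP/g0; rewrite raddfB hK subrr.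
Qed.

Lemma pi_eq0 (A : zmodType) (I : zmodClosed A) (x : A) :
  \pi_(Quotient.quot I) x = 0 <-> x \in I.
Proof.
rewrite -(raddf0 \pi_(Quotient.quot I)) -[x in x \in I]subr0.
by rewrite Quotient.idealrBE; split=> [->//|/eqP].
Qed.

Definition Zmod_proj (l : nat) : {additive int -> Zmod l} := \pi_(Zmod l).

Lemma Zmod_proj_eq0 l (x : int) : Zmod_proj l x = 0 <-> (l%:Z %| x)%Z.
Proof. exact: pi_eq0. Qed.

Lemma Zmod_proj_surj l (y : Zmod l) : exists x, Zmod_proj l x = y.
Proof. by exists (repr y); exact: reprK. Qed.

Section Reduction.
Variables (l : nat) (J : finType).

Definition reduce (c : freeab J) : {ffun J -> Zmod l} :=
  [ffun j => Zmod_proj l (c j)].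

Lemma reduce_is_zmod_morphism : zmod_morphism reduce.
Proof. by move=> c d; apply/ffunP=> j; rewrite !ffunE raddfB. Qed.

HB.instance Definition _ :=
  GRing.isZmodMorphism.Build (freeab J) {ffun J -> Zmod l} reduce
    reduce_is_zmod_morphism.

Lemma reduce_eq0 c : reduce c = 0 -> exists t, c = t *~ l.
Proof.
move=> /ffunP c0; exists [ffun j => (c j %/ l)%Z]; apply/ffunP=> j.
rewrite ffunMzE ffunE mulrzz divzK //; apply/Zmod_proj_eq0.
by have := c0 j; rewrite !ffunE.
Qed.

Lemma reduce_surj (v : {ffun J -> Zmod l}) : exists c, reduce c = v.
Proof.
have /choice[c cv] j := Zmod_proj_surj (v j).
by exists (finfun c); apply/ffunP=> j; rewrite !ffunE cv.
Qed.

Lemma Zmod_torsion (v : {ffun J -> Zmod l}) : v *+ l = 0.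
Proof.
have [c <-] := reduce_surj v; apply/ffunP=> j.
rewrite ffunMnE !ffunE -raddfMn /=; apply/Zmod_proj_eq0.
by rewrite pmulrn mulrzz dvdz_mull.
Qed.
End Reduction.
Arguments reduce l {J} c.

Lemma freeab_hom_eq0 (T : finType) (V : zmodType)
    (g : {additive freeab T -> V}) c :
  (forall t, g (gen t) = 0) -> g c = 0.
Proof.
move=> g0; rewrite [c]freeabE raddf_sum big1 // => t _.
by rewrite raddfMz g0 mul0rz.
Qed.

Section MatrixOfAdditive.
Variables S T : finType.

Definition coord_row (U : finType) (v : freeab U) : 'rV[int]_#|U| :=
  \row_i v (enum_val i).

Lemma coord_row_inj U : injective (@coord_row U).
Proof.
move=> v w /rowP vw; apply/ffunP=> s.
by have := vw (enum_rank s); rewrite !mxE enum_rankK.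
Qed.

Definition row_coord (U : finType) (v : 'rV[int]_#|U|) : freeab U :=
  [ffun s => v 0 (enum_rank s)].

Lemma row_coordK U : cancel (@row_coord U) (@coord_row U).
Proof. by move=> v; apply/rowP=> i; rewrite !mxE ffunE enum_valK. Qed.

Definition matrix_of (g : freeab S -> freeab T) : 'M[int]_(#|S|, #|T|) :=
  \matrix_(i, j) g (gen (enum_val i)) (enum_val j).

Lemma coord_row_matrix_of (g : {additive freeab S -> freeab T}) v :
  coord_row (g v) = coord_row v *m matrix_of g.
Proof.
apply/rowP=> j; rewrite !mxE {1}[v]freeabE raddf_sum sum_ffunE.
rewrite (big_enum_val (A := {: S})) /=; apply: eq_bigr => i _.
by rewrite !mxE raddfMz ffunMzE mulrzz mulrC.
Qed.

Definition of_matrix (A : 'M[int]_(#|S|, #|T|)) :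
    {additive freeab S -> freeab T} :=
  extend (fun s => [ffun t => A (enum_rank s) (enum_rank t)]).

Lemma coord_row_of_matrix A v :
  coord_row (of_matrix A v) = coord_row v *m A.
Proof.
apply/rowP=> j; rewrite !mxE sum_ffunE.
rewrite (big_enum_val (A := {: S})) /=; apply: eq_bigr => i _.
by rewrite ffunMzE ffunE !enum_valK mxE mulrzz mulrC.
Qed.
End MatrixOfAdditive.

Lemma freeab_kernel (I C I' : finType) r (mu : int)
    (delta : {additive freeab I -> freeab C})
    (p : {additive freeab C -> freeab I'})
    (s : {additive freeab I' -> freeab C}) :
  (forall x, p (delta x) = 0) -> cancel s p -> mu != 0 ->
  (forall v, p v = 0 -> exists y, delta y = v *~ mu) ->
  (r + #|C| = #|I| + #|I'|)%N ->
  exists (ret : {additive freeab I -> freeab 'I_r})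
         (inc : {additive freeab 'I_r -> freeab I}),
    [/\ forall x, delta (inc x) = 0, cancel inc ret
      & forall v, delta v = 0 -> inc (ret v) = v].
Proof.
move=> pd sK mu0 sat rE.
have mxP (U V : finType) (A B : 'M[int]_(#|U|, #|V|)) :
    (forall v : freeab U, coord_row v *m A = coord_row v *m B) -> A = B.
  move=> AB; apply/row_matrixP=> i.
  by rewrite !rowE -[delta_mx _ _]row_coordK AB.
have coord_row0 (U : finType) : coord_row (0 : freeab U) = 0.
  by apply/rowP=> i; rewrite !mxE ffunE.
have [] := @int_kernel _ _ _ #|'I_r| (matrix_of delta) (matrix_of p)
  (matrix_of s) mu.
- apply: mxP => v; rewrite mulmxA -!coord_row_matrix_of pd mulmx0.
  exact: coord_row0.
- by apply: mxP => v; rewrite mulmxA -!coord_row_matrix_of sK mulmx1.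
- by [].
- move=> v; rewrite -[v]row_coordK -coord_row_matrix_of -(coord_row0 I').
  move=> /coord_row_inj/sat[y yv]; exists (coord_row y).
  rewrite -coord_row_matrix_of yv; apply/rowP=> i.
  by rewrite !mxE ffunMzE mulrzz mulrC.
- by rewrite card_ord.
move=> ret [inc [incD incK retK]]; exists (of_matrix ret), (of_matrix inc).
split=> [x|x|v dv]; apply: coord_row_inj.
- rewrite coord_row_matrix_of coord_row_of_matrix -mulmxA incD mulmx0.
  exact/esym/coord_row0.
- by rewrite !coord_row_of_matrix -mulmxA incK mulmx1.
- rewrite !coord_row_of_matrix; apply: retK.
  by rewrite -coord_row_matrix_of dv coord_row0.
Qed.

(** An isomorphism of the cokernel of [d] with [Z^I + (Z/l)^J], given by lifts
    of the coordinates and of the generators to [B] itself, so that it can be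
    written without quotients; the torsion coordinates matter modulo [l] only.
    The last clause excludes torsion summands that would be infinite. *)
Record coker_split (A B : zmodType) (d : {additive A -> B}) (I J : finType)
    (l : nat) := CokerSplit {
  free_coord : {additive B -> freeab I};
  tors_coord : {additive B -> freeab J};
  free_lift : {additive freeab I -> B};
  tors_lift : {additive freeab J -> B};
  free_coord_bd : forall a, free_coord (d a) = 0;
  tors_coord_bd : forall a, reduce l (tors_coord (d a)) = 0;
  free_liftK : cancel free_lift free_coord;
  tors_coord_free : forall u, tors_coord (free_lift u) = 0;
  free_coord_tors : forall t, free_coord (tors_lift t) = 0;
  tors_liftK : forall t, reduce l (tors_coord (tors_lift t)) = reduce l t;
  coker_decomp : forall z, exists a,
    d a = z - free_lift (free_coord z) - tors_lift (tors_coord z);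
  tors_lift_bd : forall t, exists a, d a = tors_lift t *~ l;
  split_order_gt0 : (0 < l)%N || (#|J| == 0)%N
}.

Lemma tors_lift_bd_mult (A B : zmodType) (d : {additive A -> B}) I J l
    (S : coker_split d I J l) :
  exists2 mu : int, mu != 0 & forall t, exists a, d a = tors_lift S t *~ mu.
Proof.
have [l0|/eqP J0] := orP (split_order_gt0 S).
  by exists l%:Z => [|t]; [lia | exact: tors_lift_bd].
exists 1 => // t; exists 0; rewrite raddf0 mulr1z.
suff -> : t = 0 by rewrite raddf0.
by apply/ffunP=> j; have := card0_eq J0 j.
Qed.

Section HomologyOfSplit.
Variables (A B C : zmodType) (d1 : {additive A -> B}) (d0 : {additive B -> C}).
Variables (I J I' J' K : finType) (l l' r : nat).
Variables (S1 : coker_split d1 I J l) (S0 : coker_split d0 I' J' l').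
Variables (chi : {additive C -> freeab K}) (chi' : {additive freeab K -> C}).
Hypothesis d0d1 : forall a, d0 (d1 a) = 0.
Hypotheses (chiK : cancel chi chi') (chi'K : cancel chi' chi).
Hypothesis rE : (r + #|K| = #|I| + #|I'|)%N.

(** Torsion goes to zero because [C] is torsion free. *)
Lemma diff_tors_lift t : d0 (tors_lift S1 t) = 0.
Proof.
have [mu mu0 /(_ t)[a da]] := tors_lift_bd_mult S1.
have : chi (d0 (tors_lift S1 t)) *~ mu = 0.
  by rewrite -[X in X *~ _]/((chi \o d0) _) -raddfMz -da /= d0d1 raddf0.
move=> ct; apply: (can_inj chiK); rewrite raddf0; apply/ffunP=> k.
have /ffunP/(_ k) := ct; rewrite ffunMzE !ffunE => /eqP.
by rewrite mulrz_eq0 (negPf mu0) => /eqP.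
Qed.

Lemma diff_free_part z : d0 z = d0 (free_lift S1 (free_coord S1 z)).
Proof.
have [a /(congr1 d0)] := coker_decomp S1 z.
rewrite d0d1 !raddfB diff_tors_lift subr0 => /esym/eqP.
by rewrite subr_eq0 => /eqP.
Qed.

(** The homology is the kernel of the map from the cokernel of [d1] to [C].
    The torsion lies in it, and on the free part it is the kernel of an
    integer matrix whose cokernel has rank [#|I'|], which fixes its rank. *)
Lemma homology_split :
  homology_at d1 d0 ≅ (int ^ r * {ffun J -> Zmod l})%type.
Proof.
pose delta : {additive freeab I -> freeab K} := chi \o d0 \o free_lift S1.
pose p : {additive freeab K -> freeab I'} := free_coord S0 \o chi'.
pose s : {additive freeab I' -> freeab K} := chi \o free_lift S0.
have [mu mu0 tb] := tors_lift_bd_mult S0.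
have [||v pv|ret [inc [dinc incK retK]]] :=
    @freeab_kernel I K I' r mu delta p s _ _ mu0 _ rE.
- by move=> x; rewrite /= chiK free_coord_bd.
- by move=> x; rewrite /= chiK free_liftK.
- have [b db] := coker_decomp S0 (chi' v).
  have [b' db'] := tb (tors_coord S0 (chi' v)).
  exists (free_coord S1 (b *~ mu + b')).
  rewrite /= -diff_free_part raddfD /= raddfMz db db'.
  have -> : free_coord S0 (chi' v) = 0 by [].
  by rewrite raddf0 subr0 mulrzBl subrK raddfMz /= chi'K.
pose phi (z : cycles d0) : int ^ r * {ffun J -> Zmod l} :=
  (ret (free_coord S1 (val z)), reduce l (tors_coord S1 (val z))).
have phi_add : zmod_morphism phi.
  by move=> x y; rewrite /phi; congr (_, _); rewrite !raddfB.
pose phiA : {additive cycles d0 -> (int ^ r * {ffun J -> Zmod l})%type} :=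
  HB.pack phi (GRing.isZmodMorphism.Build _ _ phi phi_add).
have phi_bd z : z \in boundaries d1 (d0 := d0) -> phiA z = 0.
  move=> /asboolP[a da]; rewrite /= /phi -[val z]/(cycle_val z) -da.
  by rewrite free_coord_bd raddf0 tors_coord_bd.
exists (quot_lift phi_bd); apply: additive_bijective.
  (* The torsion coordinates of a cycle in the kernel are multiples of l, and
     l times a lift of torsion is a boundary. *)
  elim/quotW=> z; rewrite [X in X = 0 -> _](quot_liftE phi_bd z) => -[z1 z2].
  apply/pi_eq0/asboolP.
  have /eqP dz : cycle_val z \in ker_pred d0 by case: (z).
  have fz : free_coord S1 (val z) = 0.
    rewrite -[LHS]retK ?z1 ?raddf0 //=.
    by rewrite -diff_free_part dz raddf0.
  have [t tz] := reduce_eq0 z2.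
  have [a da] := coker_decomp S1 (val z).
  have [a' da'] := tors_lift_bd S1 t.
  exists (a + a'); rewrite raddfD /= da da' fz raddf0 subr0 tz.
  by rewrite raddfMz subrK.
move=> [u tau].
have [t tE] := reduce_surj tau.
pose b := free_lift S1 (inc u) + tors_lift S1 t.
have db : b \in ker_pred d0.
  apply/eqP; rewrite raddfD /= diff_tors_lift addr0.
  by apply: (can_inj chiK); rewrite raddf0; exact: dinc.
exists (\pi_(Quotient.quot _) (Cycle db)).
rewrite [LHS](quot_liftE phi_bd); congr (_, _) => /=.
  by rewrite raddfD /= free_liftK free_coord_tors addr0 incK.
by rewrite raddfD /= tors_coord_free add0r tors_liftK tE.
Qed.
End HomologyOfSplit.

(** * Cycles and components of a functional graph *)

Lemma dvdz_eq (d a b : int) : a = b -> (d %| a)%Z -> (d %| b)%Z.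
Proof. by move=> ->. Qed.

Section FunctionGraphTheory.
Variables (X0 : finType) (f : X0 -> X0).
Local Notation l := (cycle_gcd f).

(** The least period of [x] divides [d], and the orbit of [x] is then a simple
    cycle of that length. *)
Lemma cycle_gcd_dvd_period d x : iter d f x = x -> (l %| d)%N.
Proof.
case: d => [|d dx]; first by rewrite dvdn0.
have pT := @orbitPcycle _ f x.
have cyc : fcycle f (orbit f x) by apply/(pT 3 0); exists d.
have itk : iter (order f x) f x = x by apply/(pT 3 4); exists d.
have kd : (order f x %| d.+1)%N.
  have rlt : (d.+1 %% order f x < order f x)%N by rewrite ltn_mod order_gt0.
  have : iter (d.+1 %% order f x) f x = x.
    rewrite -[RHS]dx {2}(divn_eq d.+1 (order f x)) addnC iterD mulnC.
    congr iter; elim: (_ %/ _)%N => [|q IH]; rewrite ?muln0 //.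
    by rewrite mulnS iterD -IH itk.
  by move/(congr1 (findex f x)); rewrite findex_iter // findex0 => /eqP.
apply: dvdn_trans kd; rewrite /cycle_gcd -big_filter.
have kin : order f x \in [seq k <- index_iota 1 #|X0|.+1 |
    [exists c : k.-tuple X0, ucycleb (frel f) c]].
  rewrite mem_filter mem_index_iota order_gt0 ltnS max_card !andbT.
  apply/existsP; exists (tcast (size_orbit f x) (in_tuple (orbit f x))).
  by rewrite val_tcast /= /ucycleb cyc orbit_uniq.
by rewrite (big_rem _ kin) /= dvdn_gcdl.
Qed.

Lemma cycle_gcd_dvd_iter a b x :
  iter a f x = iter b f x -> (l%:Z %| a%:Z - b%:Z)%Z.
Proof.
wlog ba : a b / (b <= a)%N => [H ab|ab].
  by have [/H->//|/ltnW/H] := leqP b a; rewrite -opprB rpredN => ->.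
rewrite subzn //; apply: (@cycle_gcd_dvd_period _ (iter b f x)).
by rewrite -iterD subnK.
Qed.

Lemma cycle_gcd_gt0 : (0 < #|X0|)%N -> (0 < l)%N.
Proof.
case/card_gt0P=> x _; rewrite lt0n; apply/eqP=> l0.
have inj : injective (fun i : 'I_#|X0|.+1 => iter i f x).
  move=> i j ij; apply: val_inj; apply/eqP; have := cycle_gcd_dvd_iter ij.
  by rewrite l0 dvd0z subr_eq0.
by have := leq_card _ inj; rewrite card_ord ltnn.
Qed.

(** The set of integers that kill [v] is closed under gcd, by Bezout. *)
Lemma mulrn_cycle_gcd (V : zmodType) (v : V) :
  (forall x k, iter k f x = x -> v *+ k = 0) -> v *+ l = 0.
Proof.
move=> vk; rewrite /cycle_gcd.
apply: (big_ind (fun n => v *+ n = 0)) => // [m n vm vn|k].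
  have [->|m0] := posnP m; first by rewrite gcd0n.
  have [a _ /dvdnP[q qE]] := Bezoutl n m0.
  have : v *+ (q * m) = 0 by rewrite mulnC mulrnA vm mul0rn.
  by rewrite -qE mulrnDr [(a * n)%N]mulnC mulrnA vn mul0rn addr0.
case/existsP=> c /andP[cc _]; case: (posnP k) => [->//|k0].
have : size c = k by rewrite size_tuple.
case: (tval c) cc k0 => [|x p] /= xp k0 sk; first by rewrite -sk in k0.
apply: (vk x); move: xp; rewrite -sk rcons_path => /andP[/fpathP[n ->] /eqP].
by rewrite last_traject size_traject -iterS.
Qed.

(** Components are indexed by their canonical representatives. *)
Definition anchor (x : X0) : X0 :=
  fingraph.root [rel x y | (f x == y) || (f y == x)] x.

Let e := [rel x y | (f x == y) || (f y == x)].
Let sym_e : connect_sym e.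
Proof. by apply: sym_connect_sym => x y /=; rewrite orbC. Qed.

Lemma anchor_f x : anchor (f x) = anchor x.
Proof. by apply/eqP; rewrite eq_sym root_connect // connect1 //= eqxx. Qed.

Lemma anchor_idem x : anchor (anchor x) = anchor x.
Proof. exact/eqP/(roots_root sym_e). Qed.

(** In a functional graph, connected vertices have forward orbits that meet. *)
Lemma iter_anchor x : exists i j, iter i f x = iter j f (anchor x).
Proof.
have /connectP[p] := connect_root e x; rewrite -/(anchor x).
elim: p x (anchor x) => [|y p IH] x z /=.
  by move=> _ ->; exists 0%N, 0%N.
case/andP=> xy ep /(IH _ _ ep)[i [j ij]].
case/orP: xy => /eqP xy; first by exists i.+1, j; rewrite iterSr xy.
by exists i, j.+1; rewrite -xy iterS -ij -iterS -iterSr.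
Qed.

(** When the forward orbits of [x] and of its anchor meet after [i] and [j]
    steps, the height of [x] must be [j - i]; other meeting points change this
    by a period, hence by a multiple of [l]. *)
Lemma height_exists :
  {h : X0 -> int | (forall x, (l %| h (f x) - (h x + 1))%Z)
                 & forall x, h (anchor x) = 0}.
Proof.
have /choice[h0 h0P] x : exists d : int, exists i j,
    iter i f x = iter j f (anchor x) /\ d = j%:Z - i%:Z.
  by have [i [j ij]] := iter_anchor x; exists (j%:Z - i%:Z), i, j.
exists (fun x => h0 x - h0 (anchor x)) => x; last by rewrite anchor_idem subrr.
rewrite anchor_f.
have [i [j [ij ->]]] := h0P x; have [i' [j' [ij' ->]]] := h0P (f x).
rewrite anchor_f in ij'.
have /cycle_gcd_dvd_iter :
    iter (i + j') f (anchor x) = iter (i'.+1 + j)%N f (anchor x).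
  rewrite iterD -ij' -iterSr -iterD addnC; rewrite [in RHS]iterD -ij -iterD.
  by congr (iter _ f x); lia.
by apply: dvdz_eq; lia.
Qed.

Lemma affine_on_component (V : zmodType) (p : V) (G : X0 -> V) (h : X0 -> int) :
  (forall x, (l %| h (f x) - (h x + 1))%Z) -> (forall x, h (anchor x) = 0) ->
  (forall x, G (f x) = G x + p) -> p *+ l = 0 ->
  forall x, G x = G (anchor x) + p *~ h x.
Proof.
move=> hf hc Gf pl x; have [i [j ij]] := iter_anchor x.
have Gi y n : G (iter n f y) = G y + p *+ n.
  by elim: n => [|n IH]; rewrite ?addr0 //= Gf IH mulrSr addrA.
have hi y n : (l %| h (iter n f y) - (h y + n%:Z))%Z.
  elim: n => [|n IH] /=; first by rewrite addr0 subrr dvdz0.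
  by apply: dvdz_eq (rpredD (hf (iter n f y)) IH); lia.
have lp m : (l %| m)%Z -> p *~ m = 0.
  by case/dvdzP=> q ->; rewrite mulrC mulrzA -pmulrn pl mul0rz.
have hx : (l %| h x - (j%:Z - i%:Z))%Z.
  have := hi x i; rewrite ij => hxi.
  by apply: dvdz_eq (rpredB (hi (anchor x) j) hxi); rewrite hc; lia.
apply: (addIr (p *+ i)); rewrite -Gi ij Gi -addrA; congr (_ + _).
rewrite !pmulrn -mulrzDr; apply/eqP; rewrite -subr_eq0 -mulrzBr; apply/eqP/lp.
by move: hx; rewrite -rpredN; apply: dvdz_eq; lia.
Qed.
End FunctionGraphTheory.

(** * Cocycles on words *)

Section AlternatingSum.
Variables (X : eqType) (star : X -> X -> X).

(** On the word [x_0 ... x_k] this is the sum of [(-1)^i F x_i (x_0 ⋆ x_i,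
    ..., x_(i-1) ⋆ x_i, x_(i+1), ..., x_k)], see [altsumE]. The second
    argument of [F] is the face [d^i], so [F y r := G r] yields [G] of the
    boundary; the first argument keeps the letter [x_i], because the faces of
    [a w] for [a <> b] and of [b w] have [x_i] and [f x_i] in front of those
    of [w]. *)
Fixpoint altsum (V : zmodType) (F : X -> seq X -> V) (w : seq X) : V :=
  if w is x :: w' then F x w' - altsum (fun y r => F y (star x y :: r)) w'
  else 0.

Definition nondeg (s : seq X) : bool := sorted (fun x y => x != y) s.

Definition normalized (V : zmodType) (G : seq X -> V) :=
  forall s, ~~ nondeg s -> G s = 0.

(** These are the homomorphisms to [V] from the cokernel of the normalized
    boundary. All lengths are treated at once: a cocycle in one degree is
    extended by zero to words of other lengths. *)
Definition cocycle (V : zmodType) (G : seq X -> V) :=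
  normalized G /\ forall s, altsum (fun _ => G) s = 0.

Lemma eq_altsum (V : zmodType) (F F' : X -> seq X -> V) w :
  (forall y r, F y r = F' y r) -> altsum F w = altsum F' w.
Proof.
elim: w F F' => //= x w IH F F' FF'; rewrite FF'; congr (_ - _).
by apply: IH => y r; rewrite FF'.
Qed.

Lemma altsum_raddf (U V : zmodType) (T : {additive U -> V})
    (F : X -> seq X -> U) w :
  T (altsum F w) = altsum (fun y r => T (F y r)) w.
Proof. by elim: w F => [|x w IH] F /=; rewrite ?raddf0 // raddfB IH. Qed.

Lemma altsum0 (V : zmodType) (F : X -> seq X -> V) w :
  (forall y r, F y r = 0) -> altsum F w = 0.
Proof.
by elim: w F => //= x w IH F F0; rewrite F0 IH ?subr0 // => y r; rewrite F0.
Qed.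

Lemma altsumN (V : zmodType) (F : X -> seq X -> V) w :
  altsum (fun y r => - F y r) w = - altsum F w.
Proof.
by elim: w F => [|x w IH] F /=; rewrite ?oppr0 // IH opprB opprK addrC.
Qed.

Lemma altsumB (V : zmodType) (F F' : X -> seq X -> V) w :
  altsum (fun y r => F y r - F' y r) w = altsum F w - altsum F' w.
Proof.
elim: w F F' => [|x w IH] F F' /=; rewrite ?subr0 // IH !opprB.
by rewrite addrACA [in RHS]addrACA [- _ + _]addrC.
Qed.

Lemma altsumMn (V : zmodType) (F : X -> seq X -> V) n w :
  altsum F w *+ n = altsum (fun y r => F y r *+ n) w.
Proof. by elim: w F => [|x w IH] F /=; rewrite ?mul0rn // mulrnBl IH. Qed.

Lemma eq_altsum_size (V : zmodType) (F F' : X -> seq X -> V) w :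
  (forall y r, size w = (size r).+1 -> F y r = F' y r) ->
  altsum F w = altsum F' w.
Proof.
elim: w F F' => //= x w IH F F' FF'; rewrite FF' //; congr (_ - _).
by apply: IH => y r wr; rewrite FF' // wr.
Qed.

Lemma altsumE (V : zmodType) x0 (F : X -> seq X -> V) w :
  altsum F w = \sum_(i < size w) F (nth x0 w i)
     ([seq star x (nth x0 w i) | x <- take i w] ++ drop i.+1 w) *~ (-1) ^+ i.
Proof.
elim: w F => [|x w IH] F /=; first by rewrite big_ord0.
rewrite big_ord_recl /= mulr1z drop0 IH; congr (_ + _).
rewrite -sumrN; apply: eq_bigr => i _.
by rewrite /bump /= exprS mulN1r mulrNz.
Qed.

Hypothesis star_idem : forall x, star x x = x.

Lemma nondeg_cons x s : ~~ nondeg s -> ~~ nondeg (x :: s).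
Proof. by apply: contra; case: s => //= y s /andP[]. Qed.

Lemma nondeg_eq x s : ~~ nondeg (x :: x :: s).
Proof. by rewrite /= eqxx. Qed.

(** If two adjacent letters are equal, their two terms have the same word [r]
    and opposite signs, and in all the other terms [r] is degenerate. *)
Lemma altsum_degen (V : zmodType) (F : X -> seq X -> V) w :
  (forall y r, ~~ nondeg r -> F y r = 0) -> ~~ nondeg w -> altsum F w = 0.
Proof.
elim: w F => [//|x w IH] F F0 dw /=.
case: w IH dw => [//|y w] IH /=; rewrite negb_and negbK => /orP[/eqP <-|dw].
  rewrite star_idem [X in _ - (_ - X)]altsum0 ?subr0 ?subrr // => z r.
  by rewrite F0 // nondeg_eq.
have /= -> := IH (fun z r => F z (star x z :: r)) _ dw.
  by rewrite F0 // subr0.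
by move=> z r /(nondeg_cons (star x z)) /F0.
Qed.
End AlternatingSum.

Section FSpindleCocycles.
Variables (X0 : finType) (f : X0 -> X0).
Local Notation X := (option X0).
Local Notation op := (fspindle_op f).
Local Notation fhat := (fspindle_op f None).
Local Notation asum := (altsum op).
Let idem : forall x, op x x = x := @fspindle_idem X0 f.

Section Cocycle.
Variables (V : zmodType) (G : seq X -> V).
Hypotheses (nG : normalized G) (bG : forall s, asum (fun _ => G) s = 0).

Let G0 x s : G (x :: x :: s) = 0. Proof. exact/nG/nondeg_eq. Qed.
Let G1 x y s : G (x :: y :: y :: s) = 0.
Proof. exact/nG/nondeg_cons/nondeg_eq. Qed.
Let G2 x y z s : G (x :: y :: z :: z :: s) = 0.
Proof. exact/nG/nondeg_cons/nondeg_cons/nondeg_eq. Qed.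

(** The amount by which [G] grows along every edge of the graph of [f] put in
    front of [w], see [cocycle_step]. *)
Definition increment (w : seq X) : V :=
  asum (fun y r => G (fhat y :: y :: r)) w.

(** When [w] starts outside the basepoint, only the first term is not
    degenerate. *)
Lemma increment_cons x w :
  increment (Some x :: w) = G (Some (f x) :: Some x :: w).
Proof.
by rewrite /increment /= [X in _ - X]altsum0 ?subr0 // => y r; rewrite G1.
Qed.

(** This is the boundary of the word [b x w]. *)
Lemma cocycle_step x w : G (Some (f x) :: w) = G (Some x :: w) + increment w.
Proof.
have /= := bG [:: None, Some x & w].
by rewrite -/(increment w) opprB addrA => /eqP; rewrite subr_eq0 => /eqP.
Qed.

(** This is the boundary of the word [a b u] for any [a] other than [b]; if
    there is no such [a], then every term has two equal letters [b] in front. *)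
Lemma altsum_edge u : asum (fun y r => G (y :: fhat y :: r)) u = 0.
Proof.
have [/existsP[a _]|no] := boolP [exists a : X0, true].
  by have /= := bG [:: Some a, None & u]; rewrite opprB addrC subrK.
apply: altsum0 => -[y|] r; last exact: G0.
by case/existsP: no; exists y.
Qed.

(** In front of [f y r], the step from [y] to [f y] ends at a degenerate word,
    so the increment [G (f (f y), f y, r)] is the opposite of [G (y, f y, r)]:
    up to sign this is the sum of [altsum_edge]. *)
Lemma altsum_edge_f u :
  asum (fun y r => G (fhat (fhat y) :: fhat y :: r)) u = 0.
Proof.
rewrite -[RHS]oppr0 -(altsum_edge u) -altsumN; apply: eq_altsum => -[y|] r /=.
  apply/eqP; rewrite -addr_eq0 addrC -increment_cons; apply/eqP.
  by rewrite -cocycle_step G0.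
by rewrite !G0 oppr0.
Qed.

(** For [y] other than [b], the increment of [y r] with a correction that does
    not depend on [y] and is chosen so that the value is zero for [y] in the
    image of [f]. *)
Definition tors_gen (y : X) (r : seq X) : V :=
  G (fhat y :: y :: r) -
  (if y is Some _ then
     asum (fun z s => G (fhat (fhat z) :: fhat z :: z :: s)) r else 0).

(** The two terms are those of [altsum_edge_f] for the word [x w]. *)
Lemma tors_gen_f x w : tors_gen (Some (f x)) w = 0.
Proof.
have /= := altsum_edge_f (Some x :: w); rewrite /tors_gen => <-.
by congr (_ - _).
Qed.

Lemma tors_gen_None w : tors_gen None w = 0.
Proof. by rewrite /tors_gen G0 subr0. Qed.

Lemma tors_gen_degen y r : ~~ nondeg r -> tors_gen y r = 0.
Proof.
move=> dr; rewrite /tors_gen nG; last exact/nondeg_cons/nondeg_cons.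
rewrite sub0r; case: y => [y|]; rewrite ?oppr0 // altsum_degen ?oppr0 //.
by move=> z s ds; apply/nG/nondeg_cons/nondeg_cons/nondeg_cons.
Qed.

(** All increments are combinations of the generators [tors_gen y r]. The
    corrections cancel: for a word starting outside [b] the one of the first
    letter is the sum of the others, and for a word starting with [b] each is
    zero by [tors_gen_f]. *)
Lemma altsum_tors_gen w : asum tors_gen w = increment w.
Proof.
rewrite /tors_gen altsumB -/(increment w) -[RHS]subr0; congr (_ - _).
have f3 z s : G (Some (f (f (f z))) :: Some (f (f z)) :: Some (f z) :: s) = 0.
  have := tors_gen_f z (Some (f z) :: s); rewrite /tors_gen /= G1 sub0r.
  rewrite [X in _ - X]altsum0 ?subr0 => [/eqP|y r]; rewrite ?oppr_eq0 ?G2 //.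
  by move/eqP.
case: w => [|[x|] u] //=; last first.
  rewrite sub0r altsum0 ?oppr0 // => -[y|] r //=; rewrite f3 sub0r.
  by rewrite altsum0 ?oppr0 // => z s; rewrite G2.
apply/eqP; rewrite subr_eq0; apply/eqP/eq_altsum => -[y|] r /=; last first.
  by rewrite G0.
by rewrite [X in _ - X]altsum0 ?subr0 // => z s; rewrite G2.
Qed.

Local Notation l := (cycle_gcd f).

(** Walking once around a cycle adds the increment as many times as the cycle
    is long, and returns to the same value. *)
Lemma increment_torsion w : increment w *+ l = 0.
Proof.
apply: (@mulrn_cycle_gcd _ f) => x k xk.
have : G (Some (iter k f x) :: w) = G (Some x :: w) + increment w *+ k.
  elim: (k) => [|n IH]; first by rewrite addr0.
  by rewrite [iter _ _ _]/= cocycle_step IH mulrSr addrA.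
by rewrite xk -{1}[G _]addr0 => /addrI.
Qed.

Lemma tors_gen_torsion y r : tors_gen y r *+ l = 0.
Proof.
case: y => [y|]; last by rewrite tors_gen_None mul0rn.
rewrite /tors_gen mulrnBl -increment_cons increment_torsion sub0r altsumMn.
rewrite altsum0 ?oppr0 //.
move=> [z|] s; last by rewrite G0 mul0rn.
by rewrite -increment_cons increment_torsion.
Qed.

Definition free_gen (y : X) (w : seq X) : V :=
  if y is Some y' then G (Some (anchor f y') :: w) - G (None :: w) else 0.

(** The value at [x w] is reached from the anchor of [x] by adding the
    increment as often as the height of [x] says. The same holds for the first
    letter of [w] in the place of [x], where the value is zero; the difference
    of the two keeps its form when one of the letters is [b]. *)
Lemma cocycle_decomp (h : X0 -> int) x w :
  (forall x, (l %| h (f x) - (h x + 1))%Z) -> (forall x, h (anchor f x) = 0) ->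
  w != [::] -> let hX := oapp h 0 in
  G (x :: w) = free_gen x w - free_gen (head None w) w
               + increment w *~ (hX x - hX (head None w)).
Proof.
move=> hf hc w0 hX.
have step y : free_gen y w + increment w *~ hX y =
    G (y :: w) - G (None :: w).
  case: y => [y|] /=; last by rewrite mulr0z addr0 subrr.
  rewrite addrAC.
  rewrite -(@affine_on_component _ f _ _ (fun y => G (Some y :: w)) h) //.
    by move=> z; exact: cocycle_step.
  exact: increment_torsion.
rewrite mulrzBr addrACA -opprD !step.
case: w w0 {step} => //= y w _; rewrite G0 sub0r opprK subrK //.
Qed.
End Cocycle.

Section UniversalFreeCocycle.
Variables (V : zmodType) (kappa : X -> seq X -> V).
Hypotheses (kappa_deg : forall y r, ~~ nondeg r -> kappa y r = 0)
  (kappa_f : forall y r, kappa (fhat y) r = kappa y r).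

(** With [kappa y w] the free generator for the component of [y] and the word
    [w], and zero for [y = b], this has the first half of [cocycle_decomp] as
    its value; [kappa] is constant along edges. *)
Definition free_cocycle (s : seq X) : V :=
  if s is x :: w then kappa x w - kappa (head None w) w else 0.

Lemma free_cocycle_pair x w :
  free_cocycle (fhat x :: x :: w) = 0 /\ free_cocycle (x :: fhat x :: w) = 0.
Proof. by rewrite /= !kappa_f !subrr. Qed.

Lemma free_cocycleP : cocycle op free_cocycle.
Proof.
have nG : normalized free_cocycle.
  case=> [|x [|y w]] //=; rewrite negb_and negbK => /orP[/eqP->|dw].
    by rewrite subrr.
  by rewrite !kappa_deg ?subrr.
have G0 y r : free_cocycle (y :: y :: r) = 0 by exact/nG/nondeg_eq.
split=> // -[|x w] //; have [dw|] := boolP (nondeg (x :: w)); last first.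
  by apply: altsum_degen => // y r; exact: nG.
case: x dw => [a|]; case: w => [|[x|] w] dw //; rewrite [altsum _ _ _]/=.
- by rewrite subr0.
- by rewrite [X in _ - (_ - X)]altsum0 ?subr0 ?subrr.
- rewrite opprB addrC subrK altsum0 // => y r.
  exact: (free_cocycle_pair y r).2.
- by rewrite subr0.
- rewrite [X in _ - (_ - X)]altsum0 ?subr0 => [|y r]; last first.
    exact: (free_cocycle_pair y r).1.
  by rewrite -[Some (f x)]/(fhat (Some x)) kappa_f subrr.
Qed.

Lemma tors_gen_free_cocycle x w : tors_gen free_cocycle x w = 0.
Proof.
rewrite /tors_gen (free_cocycle_pair x w).1 sub0r.
case: x => [x|]; rewrite ?oppr0 // altsum0 ?oppr0 // => z s.
exact: (free_cocycle_pair (fhat z) (z :: s)).1.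
Qed.
End UniversalFreeCocycle.

Section UniversalTorsionCocycle.
Variables (V : zmodType) (j : X -> seq X -> V) (h : X -> int).
Local Notation l := (cycle_gcd f).
Hypotheses (j_deg : forall y r, ~~ nondeg r -> j y r = 0)
  (j_None : forall r, j None r = 0)
  (j_f : forall y r, j (fhat y) r = 0)
  (V_tors : forall v : V, v *+ l = 0)
  (h_f : forall x, (l %| h (Some (f x)) - (h (Some x) + 1))%Z)
  (h_None : h None = 0).

(** The increment, written through free symbols [j y r] in the place of
    [tors_gen y r], as in [altsum_tors_gen]. *)
Definition tors_coef (w : seq X) : V := asum j w.
Arguments tors_coef : simpl never.

(** The second half of [cocycle_decomp]. *)
Definition tors_cocycle (s : seq X) : V :=
  if s is x :: w then tors_coef w *~ (h x - h (head None w)) else 0.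

Let jdd y x r : j y (x :: x :: r) = 0. Proof. exact/j_deg/nondeg_eq. Qed.

Lemma tors_coef_deg w : ~~ nondeg w -> tors_coef w = 0.
Proof. exact: altsum_degen. Qed.

Lemma tors_coef_cons2 x y r : tors_coef (Some x :: Some y :: r) =
  j (Some x) (Some y :: r) - j (Some y) (Some y :: r).
Proof.
rewrite /tors_coef /=; congr (_ - _).
by rewrite altsum0 ?subr0 // => z s.
Qed.

(** This is what the boundary of [a b u] requires of the coefficients. *)
Lemma tors_coef_fhat u :
  asum (fun y r => if y is Some _ then tors_coef (fhat y :: r) else 0) u = 0.
Proof.
case: u => [|[x|] u] //=.
- rewrite [X in _ - X](@eq_altsum _ _ _ _ (fun y r => - j y (y :: r)));
    last first.
    move=> [y|] r /=; last by rewrite j_None oppr0.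
    by rewrite tors_coef_cons2 -[Some (f y)]/(fhat (Some y)) j_f sub0r.
  rewrite altsumN opprK /tors_coef /=.
  by rewrite -[Some (f x)]/(fhat (Some x)) j_f sub0r addNr.
- rewrite sub0r altsum0 ?oppr0 // => -[y|] r //.
  by rewrite tors_coef_deg // nondeg_eq.
Qed.

(** This is what the boundary of [b x w] requires of the coefficients. *)
Lemma tors_coef_self w :
  asum (fun y r => if y is Some _ then tors_coef (y :: r) else 0) w =
  tors_coef w.
Proof.
case: w => [|[x|] w] //=.
- rewrite altsum0 ?subr0 // => -[y|] r //.
  by rewrite tors_coef_deg // nondeg_eq.
- rewrite sub0r [tors_coef (None :: w)]/tors_coef /= j_None sub0r; congr (- _).
  apply: eq_altsum => -[y|] r; last by rewrite j_None.
  by rewrite tors_coef_cons2 -[Some (f y)]/(fhat (Some y)) j_f subr0.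
Qed.

(** The height grows by [1] along an edge only modulo [l], which suffices in a
    group killed by [l]. *)
Lemma tors_cocycle_step (v : V) y :
  v *~ (h (fhat y) - h y) = if y is Some _ then v else 0 :> V.
Proof.
case: y => [y|]; last by rewrite subrr.
have /dvdzP[q qE] := h_f y.
have -> : h (fhat (Some y)) - h (Some y) = 1 + q * l by rewrite -qE /=; lia.
by rewrite mulrzDr mulr1z mulrC mulrzA -pmulrn V_tors mul0rz addr0.
Qed.

Lemma tors_cocycle_normalized : normalized tors_cocycle.
Proof.
case=> [|x [|y w]] //=; rewrite negb_and negbK => /orP[/eqP->|dw].
  by rewrite subrr.
by rewrite tors_coef_deg ?mul0rz.
Qed.

(** So the torsion generators satisfy no relations besides [l * v = 0]. *)
Lemma tors_gen_tors_cocycle x w :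
  tors_gen tors_cocycle (Some x) w = j (Some x) w.
Proof.
have step y s : tors_cocycle (fhat y :: y :: s) =
    if y is Some _ then tors_coef (y :: s) else 0.
  exact: (tors_cocycle_step (tors_coef (y :: s)) y).
rewrite /tors_gen step.
rewrite (@eq_altsum _ _ _ _ (fun y r => - j y (y :: r))); last first.
  move=> [y|] r; rewrite step /=; last by rewrite j_None oppr0.
  by rewrite tors_coef_cons2 -[Some (f y)]/(fhat (Some y)) j_f sub0r.
by rewrite altsumN opprK /tors_coef /= subrK.
Qed.

Lemma tors_cocycleP : cocycle op tors_cocycle.
Proof.
have nG := tors_cocycle_normalized.
have G0 y r : tors_cocycle (y :: y :: r) = 0 by exact/nG/nondeg_eq.
split=> // -[|x w] //; have [dw|] := boolP (nondeg (x :: w)); last first.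
  by apply: altsum_degen => // y r; exact: nG.
case: x dw => [a|]; case: w => [|[x|] w] dw //; rewrite [altsum _ _ _]/=.
- by rewrite subr0.
- by rewrite [X in _ - (_ - X)]altsum0 ?subr0 ?subrr.
- rewrite opprB addrC subrK -[RHS]oppr0 -(tors_coef_fhat w) -altsumN.
  apply: eq_altsum => y r.
  by rewrite -opprB mulrNz tors_cocycle_step; case: y.
- by rewrite subr0.
- rewrite [X in _ - (_ - X)](@eq_altsum _ _ _ _
    (fun y r => if y is Some _ then tors_coef (y :: r) else 0)); last first.
    by move=> y r; exact: (tors_cocycle_step (tors_coef (y :: r)) y).
  rewrite tors_coef_self -[Some (f x)]/(fhat (Some x)).
  have -> : h (fhat (Some x)) - h (head None w) =
    h (fhat (Some x)) - h (Some x) + (h (Some x) - h (head None w)) by lia.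
  rewrite [X in _ - (X - _)]mulrzDr tors_cocycle_step addrAC subrr add0r.
  exact: subrr.
Qed.
End UniversalTorsionCocycle.
End FSpindleCocycles.

(** * Normalized chains of a spindle *)

Section Cokernel.
Variables (A B : zmodType) (d : {additive A -> B}).

Definition image_of : {pred B} := fun z => `[< exists a, d a = z >].

Lemma image_of_zmod_closed : zmod_closed image_of.
Proof.
split=> [|x y]; first by apply/asboolP; exists 0; rewrite raddf0.
move=> /asboolP[a <-] /asboolP[b <-]; apply/asboolP.
by exists (a - b); rewrite raddfB.
Qed.

HB.instance Definition _ :=
  GRing.isZmodClosed.Build B image_of image_of_zmod_closed.

(** Composed with [nbasis] below, this is the universal cocycle. *)
Definition coker_proj : {additive B -> Quotient.quot image_of} :=
  \pi_(Quotient.quot image_of).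

Lemma coker_proj_eq0 z : coker_proj z = 0 <-> exists a, d a = z.
Proof.
by split=> [/pi_eq0/asboolP|dz] //; apply/pi_eq0/asboolP.
Qed.
End Cokernel.

Section NormalizedChains.
Variables (X : finType) (S : spindle X).
Local Notation NC n := (normalized_chain X n).

Lemma degenerate_nondeg n (t : n.+1.-tuple X) : degenerate t = ~~ nondeg t.
Proof.
have x0 := thead t; apply/(degenerateP x0)/idP.
  move=> [k kn tk]; apply/negP => /(sortedP x0)/(_ k).
  by rewrite size_tuple => /(_ kn); rewrite tk eqxx.
apply: contraNP => no; apply/(sortedP x0) => k.
by rewrite size_tuple => kn; apply/eqP=> tk; apply: no; exists k.
Qed.

Definition word_gen n (s : seq X) : freeab (n.-tuple X) :=
  [ffun t => (tval t == s)%:R].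

Definition nproj n : {additive freeab (n.+1.-tuple X) -> NC n} :=
  \pi_(Quotient.quot (@degenerate_chain X n)).

Lemma nproj_eq0 n c : nproj n c = 0 <-> c \in @degenerate_chain X n.
Proof. exact: pi_eq0. Qed.

(** The class of a word as a chain of degree [n]; it is zero for words of any
    length other than [n + 1], in accordance with [cocycle]. *)
Definition nbasis n (s : seq X) : NC n := nproj n (word_gen n.+1 s).

Lemma word_gen_tuple n (t : n.-tuple X) : word_gen n t = gen t.
Proof. by apply/ffunP=> u; rewrite !ffunE. Qed.

Lemma nbasis_size n s : size s != n.+1 -> nbasis n s = 0.
Proof.
move=> sn; rewrite /nbasis -[RHS](raddf0 (nproj n)); congr (nproj n _).
apply/ffunP=> t; rewrite !ffunE; case: eqP => // ts.
by rewrite -ts size_tuple eqxx in sn.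
Qed.

Lemma nbasis_normalized n : normalized (nbasis n).
Proof.
move=> s ds; apply/nproj_eq0/degenerate_chainP=> t.
rewrite degenerate_nondeg negbK ffunE => nt.
by case: eqP => // ts; rewrite -ts nt in ds.
Qed.

Lemma nchain_ext n (V : zmodType) (g g' : {additive NC n -> V}) :
  (forall s, size s = n.+1 -> g (nbasis n s) = g' (nbasis n s)) -> g =1 g'.
Proof.
move=> gg z; elim/quotW: z => c; rewrite [c]freeabE !raddf_sum.
apply: eq_bigr => t _; rewrite !raddfMz; congr (_ *~ _).
by have := gg t (size_tuple t); rewrite /nbasis word_gen_tuple.
Qed.

Lemma normalized_boundary_nbasis n s :
  normalized_boundary S n (nbasis n.+1 s) = altsum S (fun _ => nbasis n) s.
Proof.
have [sn|sn] := eqVneq (size s) n.+2; last first.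
  rewrite nbasis_size // raddf0 (@eq_altsum_size _ _ _ _ (fun _ _ => 0)).
    by rewrite altsum0.
  move=> _ r sr; rewrite nbasis_size //.
  by apply: contraNneq sn => <-; rewrite sr.
have /eqP {}sn := sn; pose t := Tuple sn.
rewrite -[s]/(tval t) /nbasis word_gen_tuple [LHS]quot_mapE boundary_gen.
have x0 := thead t.
rewrite raddf_sum (altsumE _ x0) size_tuple; apply: eq_bigr => i _.
rewrite raddfMz; congr (nproj n _ *~ _).
rewrite -word_gen_tuple; congr word_gen.
apply: (@eq_from_nth _ x0).
  rewrite size_tuple size_cat size_map size_take size_drop size_tuple ltn_ord.
  by have := ltn_ord i; lia.
rewrite size_tuple => k kn.
rewrite nth_face // nth_cat size_map size_take size_tuple ltn_ord.
case: ltnP => ki.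
  by rewrite (nth_map x0) ?nth_take // size_take size_tuple ltn_ord.
by rewrite nth_drop; congr nth; lia.
Qed.

Section Cochain.
Variables (V : zmodType) (G : seq X -> V) (nG : normalized G) (n : nat).

Lemma extend_degenerate (c : freeab (n.+1.-tuple X)) :
  c \in @degenerate_chain X n -> extend (fun t : n.+1.-tuple X => G t) c = 0.
Proof.
move=> /degenerate_chainP c0; rewrite /extend big1 // => t _.
have [dt|/c0->] := boolP (degenerate t); last by rewrite mulr0z.
by rewrite nG ?mul0rz // -degenerate_nondeg.
Qed.

Definition cochain : {additive NC n -> V} := quot_lift extend_degenerate.

Lemma cochain_nbasis s : size s = n.+1 -> cochain (nbasis n s) = G s.
Proof.
move=> /eqP sn; rewrite -[s]/(tval (Tuple sn)) /nbasis word_gen_tuple.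
exact: etrans (quot_liftE _ _) (extend_gen _ _).
Qed.

Lemma cochain_altsum_nbasis F w :
  (forall y r, size w = (size r).+1 -> size (F y r) = n.+1) ->
  cochain (altsum S (fun y r => nbasis n (F y r)) w) =
  altsum S (fun y r => G (F y r)) w.
Proof.
move=> Fs; rewrite altsum_raddf; apply: eq_altsum_size => y r wr.
by rewrite cochain_nbasis // Fs.
Qed.

Lemma cochain_boundary : (forall s, altsum S (fun _ => G) s = 0) ->
  forall a, cochain (normalized_boundary S n a) = 0.
Proof.
move=> bG.
apply: (@nchain_ext _ _ (cochain \o normalized_boundary S n) \0) => s sn.
rewrite -[LHS]/(cochain (normalized_boundary S n (nbasis n.+1 s))).
rewrite normalized_boundary_nbasis cochain_altsum_nbasis ?bG //.
by move=> _ r; rewrite sn => -[].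
Qed.
End Cochain.

Lemma cocycle_of_nbasis n (V : zmodType) (q : {additive NC n -> V}) :
  (forall a, q (normalized_boundary S n a) = 0) ->
  cocycle S (fun s => q (nbasis n s)).
Proof.
move=> qd; split=> [s ds|s]; first by rewrite nbasis_normalized ?raddf0.
by rewrite -(altsum_raddf _ q) -normalized_boundary_nbasis qd.
Qed.

Definition word m := {t : m.-tuple X | nondeg t}.

Definition nondeg_word_gen m s : freeab (word m) :=
  [ffun u => (val (val u) == s)%:R].

Lemma nondeg_word_gen_normalized m : normalized (nondeg_word_gen m).
Proof.
move=> s ds; apply/ffunP=> u; rewrite !ffunE; case: eqP => // us.
by rewrite -us (valP u) in ds.
Qed.

Lemma normalized_chain_free n :
  exists (chi : {additive NC n -> freeab (word n.+1)})
         (chi' : {additive freeab (word n.+1) -> NC n}),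
    cancel chi chi' /\ cancel chi' chi.
Proof.
have [chi chiE] : exists chi : {additive NC n -> freeab (word n.+1)},
    forall u : word n.+1, chi (nbasis n (val (val u))) = gen u.
  exists (cochain (@nondeg_word_gen_normalized n.+1) n) => u.
  by rewrite cochain_nbasis ?size_tuple //; apply/ffunP=> v; rewrite !ffunE.
have [chi' chi'E] : exists chi' : {additive freeab (word n.+1) -> NC n},
    forall u, chi' (gen u) = nbasis n (val (val u)).
  by exists (extend (fun u => nbasis n (val (val u)))) => u; exact: extend_gen.
exists chi, chi'; split.
  apply: (@nchain_ext _ _ (chi' \o chi) idfun) => s sn /=.
  have [ns|ds] := boolP (nondeg s); last first.
    by rewrite nbasis_normalized // !raddf0.
  have /eqP sn' := sn; pose u : word n.+1 := exist _ (Tuple sn') ns.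
  by rewrite (chiE u) chi'E.
move=> c; rewrite [c in LHS]freeabE [RHS]freeabE !raddf_sum.
apply: eq_bigr => u _.
by rewrite !raddfMz chi'E chiE.
Qed.
End NormalizedChains.

(** * The cokernels of the boundary of an f-spindle *)

Section LabelledWords.
Variables (X0 : finType) (P : pred X0) (m : nat).
Local Notation X := (option X0).

(** Given by its coefficients, so that it vanishes by itself whenever [y] is
    [b] or fails [P], or [r] is degenerate or has the wrong length. *)
Definition label_gen (y : X) (r : seq X) : freeab ({x | P x} * word X m) :=
  [ffun p => ((Some (val p.1) == y) && (val (val p.2) == r))%:R].

Lemma label_gen_gen (p : {x | P x} * word X m) :
  label_gen (Some (val p.1)) (val (val p.2)) = gen p.
Proof.
by apply/ffunP=> q; rewrite !ffunE; congr ((_ : bool)%:R).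
Qed.

Lemma label_gen_None r : label_gen None r = 0.
Proof. by apply/ffunP=> q; rewrite !ffunE. Qed.

Lemma label_gen_notin x r : ~~ P x -> label_gen (Some x) r = 0.
Proof.
move=> Px; apply/ffunP=> q; rewrite !ffunE; case: eqP => // -[qx].
by rewrite -qx (valP q.1) in Px.
Qed.

Lemma label_gen_deg y r : ~~ nondeg r -> label_gen y r = 0.
Proof.
move=> dr; apply/ffunP=> q; rewrite !ffunE andbC; case: eqP => // qr.
by rewrite -qr (valP q.2) in dr.
Qed.

Lemma label_gen_ext (V : zmodType)
    (T : {additive freeab ({x | P x} * word X m) -> V})
    (g : X -> seq X -> V) y r :
  (forall p, T (gen p) = g (Some (val p.1)) (val (val p.2))) ->
  size r = m -> (~~ nondeg r -> g y r = 0) ->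
  (if y is Some x then ~~ P x -> g y r = 0 else g y r = 0) ->
  T (label_gen y r) = g y r.
Proof.
move=> Tg /eqP rm dr; have [nr|nr] := boolP (nondeg r); last first.
  by rewrite label_gen_deg // raddf0 dr.
case: y {dr} => [x|] gx; last by rewrite label_gen_None raddf0.
have [Px|Px] := boolP (P x); last by rewrite label_gen_notin // raddf0 gx.
by rewrite -(Tg (exist _ x Px, exist _ (Tuple rm) nr)) -label_gen_gen.
Qed.
End LabelledWords.

Section FSpindleSplit.
Variables (X0 : finType) (f : X0 -> X0).
Local Notation X := (option X0).
Local Notation op := (fspindle_op f).
Local Notation l := (cycle_gcd f).
Local Notation S := (fspindle f).
Local Notation NC n := (normalized_chain X n).

Definition component := {x : X0 | anchor f x == x}.
Definition initial := {x : X0 | x \notin codom f}.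

(** Only words of length [n' + 2] occur in [tors_gen], so [T] and [G] need to
    match on those. *)
Lemma tors_gen_raddf n' (V W : zmodType) (T : {additive V -> W})
    (G : seq X -> V) (G' : seq X -> W) y r :
  (forall s, size s = n'.+2 -> T (G s) = G' s) -> size r = n' ->
  T (tors_gen f G y r) = tors_gen f G' y r.
Proof.
move=> TG rn; rewrite /tors_gen raddfB TG /= ?rn //; congr (_ - _).
case: y => [y|]; last exact: raddf0.
rewrite altsum_raddf; apply: eq_altsum_size => z s; rewrite rn => sn.
by rewrite TG //= -sn.
Qed.

Section PositiveDegree.
Variables (m : nat) (h : X0 -> int).
Local Notation n := m.+1.
Hypotheses (hf : forall x, (l %| h (f x) - (h x + 1))%Z)
  (hc : forall x, h (anchor f x) = 0).

Definition component_gen (y : X) (w : seq X) : freeab (component * word X n) :=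
  label_gen _ n (omap (anchor f) y) w.

Definition init_gen (y : X) (w : seq X) : freeab (initial * word X m) :=
  label_gen _ m y w.

Let component_gen_deg y r : ~~ nondeg r -> component_gen y r = 0.
Proof. exact: label_gen_deg. Qed.
Let component_gen_f y r : component_gen (op None y) r = component_gen y r.
Proof. by case: y => //= y; rewrite /component_gen /= anchor_f. Qed.

Let j_deg y r : ~~ nondeg r -> init_gen y r = 0.
Proof. exact: label_gen_deg. Qed.
Let j_None r : init_gen None r = 0.
Proof. exact: label_gen_None. Qed.
Let j_f y r : init_gen (op None y) r = 0.
Proof.
case: y => [y|] //=; rewrite /init_gen label_gen_notin //.
by rewrite negbK codom_f.
Qed.

Let free_part := free_cocycleP component_gen_deg component_gen_f.
Let hX : X -> int := oapp h 0.
Let tors_normalized := @tors_cocycle_normalized _ f _ init_gen hX j_deg.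

Definition rinit_gen y w := reduce l (init_gen y w).

Let red_tors_cocycle s :
  reduce l (tors_cocycle f init_gen hX s) = tors_cocycle f rinit_gen hX s.
Proof.
case: s => [|x w] /=; first exact: raddf0.
by rewrite raddfMz; congr (_ *~ _); rewrite /tors_coef altsum_raddf.
Qed.

Let rj_deg y r : ~~ nondeg r -> rinit_gen y r = 0.
Proof. by move=> dr; rewrite /rinit_gen j_deg ?raddf0 //. Qed.
Let rj_None r : rinit_gen None r = 0.
Proof. by rewrite /rinit_gen j_None raddf0. Qed.
Let rj_f y r : rinit_gen (op None y) r = 0.
Proof. by rewrite /rinit_gen j_f raddf0. Qed.

Let rtors_part := @tors_cocycleP _ f _ _ hX rj_deg rj_None rj_f
  (@Zmod_torsion _ _) hf erefl.
Let rtors_gen := @tors_gen_tors_cocycle _ f _ _ hX rj_deg rj_None rj_f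
  (@Zmod_torsion _ _) hf erefl.

(** The identities between generators and coordinates are the evaluations of
    the two universal cocycles; the decomposition of a chain is
    [cocycle_decomp] for the projection to the cokernel. *)
Lemma fspindle_split_pos :
  inhabited (coker_split (normalized_boundary S n) (component * word X n)%type
    (initial * word X m)%type l).
Proof.
have [fc [fcE fcd]] :
    exists fc : {additive NC n -> freeab (component * word X n)},
    (forall s, size s = n.+1 ->
       fc (nbasis n s) = free_cocycle component_gen s) /\
    forall a, fc (normalized_boundary S n a) = 0.
  exists (cochain free_part.1 n); split; first exact: cochain_nbasis.
  exact: (cochain_boundary (S := S) _ free_part.2).
have [tc [tcE tcd]] :
    exists tc : {additive NC n -> freeab (initial * word X m)},
    (forall s, size s = n.+1 ->
       tc (nbasis n s) = tors_cocycle f init_gen hX s) /\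
    forall a, reduce l (tc (normalized_boundary S n a)) = 0.
  exists (cochain tors_normalized n); split; first exact: cochain_nbasis.
  pose g := cochain rtors_part.1 n.
  move=> a.
  rewrite -[RHS](cochain_boundary (S := S) rtors_part.1 rtors_part.2 a).
  move: (normalized_boundary S n a).
  apply: (@nchain_ext _ _ _ (reduce l \o cochain tors_normalized n) g) => s sn.
  rewrite -[LHS]/(reduce l (cochain tors_normalized n _)).
  by rewrite !cochain_nbasis // red_tors_cocycle.
have [fl flE] : exists fl : {additive freeab (component * word X n) -> NC n},
    forall p, fl (gen p) = nbasis n (Some (val p.1) :: val (val p.2)) -
                           nbasis n (None :: val (val p.2)).
  exists (extend (fun p => nbasis n (Some (val p.1) :: val (val p.2)) -
                           nbasis n (None :: val (val p.2)))).
  by move=> p; exact: extend_gen.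
have [tl tlE] : exists tl : {additive freeab (initial * word X m) -> NC n},
    forall p, tl (gen p) =
              tors_gen f (nbasis n) (Some (val p.1)) (val (val p.2)).
  exists (extend (fun p =>
    tors_gen f (nbasis n) (Some (val p.1)) (val (val p.2)))).
  by move=> p; exact: extend_gen.
(* An opaque projection to the cokernel: [z] is a boundary when [Q z = 0]. *)
have [QT [Q Q0]] : exists (QT : zmodType) (Q : {additive NC n -> QT}),
    forall z, Q z = 0 <-> exists a, normalized_boundary S n a = z.
  by exists _, (coker_proj (normalized_boundary S n)); exact: coker_proj_eq0.
have [nG bG] : cocycle op (fun s => Q (nbasis n s)).
  by apply: (@cocycle_of_nbasis _ S) => a; apply/Q0; exists a.
have Qtl p : Q (tl (gen p)) =
    tors_gen f (fun s => Q (nbasis n s)) (Some (val p.1)) (val (val p.2)).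
  by rewrite tlE; apply: (tors_gen_raddf (n' := m)); rewrite ?size_tuple.
constructor; apply: (@CokerSplit _ _ _ _ _ _ fc tc fl tl) => //.
- move=> u; rewrite -[RHS]/(idfun u); apply/eqP; rewrite -subr_eq0; apply/eqP.
  apply: (@freeab_hom_eq0 _ _ ((fc \o fl) \- idfun)) => p /=.
  rewrite flE raddfB !fcE ?size_tuple //=; try by rewrite size_tuple.
  rewrite /component_gen /= label_gen_None sub0r opprK subrK.
  by rewrite (eqP (valP p.1)) label_gen_gen subrr.
- move=> u; apply: (@freeab_hom_eq0 _ _ (tc \o fl)) => p /=.
  rewrite flE raddfB !tcE /= ?size_tuple // -mulrzBr /hX /=.
  rewrite -(eqP (valP p.1)) hc sub0r.
  by rewrite subrr mulr0z.
- move=> t; apply: (@freeab_hom_eq0 _ _ (fc \o tl)) => p /=.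
  rewrite tlE (tors_gen_raddf (n' := m) (G' := free_cocycle component_gen))
    ?size_tuple //.
  exact: tors_gen_free_cocycle.
- move=> t; apply/eqP; rewrite -subr_eq0; apply/eqP.
  apply: (@freeab_hom_eq0 _ _ ((reduce l \o tc \o tl) \- reduce l)) => p /=.
  rewrite tlE -[reduce l (tc _)]/((reduce l \o tc) _).
  rewrite (tors_gen_raddf (n' := m) (G' := tors_cocycle f rinit_gen hX))
    ?size_tuple //.
    by rewrite rtors_gen /rinit_gen /init_gen label_gen_gen subrr.
  by move=> s sn /=; rewrite tcE // red_tors_cocycle.
- move=> z; apply/Q0.
  rewrite -addrA -opprD raddfB; apply/eqP; rewrite subr_eq0; apply/eqP.
  move: z; apply: (@nchain_ext _ _ _ Q (Q \o ((fl \o fc) \+ (tl \o tc)))).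
  case=> [|x w] //= [wn].
  rewrite raddfD /= fcE /= ?wn // tcE /= ?wn //.
  have w0 : w != [::] by rewrite -size_eq0 wn.
  rewrite (cocycle_decomp nG bG x hf hc w0) -/hX.
  have Qfl y : Q (fl (component_gen y w)) =
      free_gen f (fun s => Q (nbasis n s)) y w.
    pose g (y : X) r := if y is Some y' then
      Q (nbasis n (Some y' :: r)) - Q (nbasis n (None :: r)) else 0.
    transitivity (g (omap (anchor f) y) w); last by case: y.
    apply: (label_gen_ext (T := Q \o fl) (g := g)) => //.
    - by move=> p; rewrite /= flE raddfB.
    - move=> dw; rewrite /g; case: (omap _ _) => // y'.
      by rewrite !nG ?subrr //; apply: nondeg_cons.
    - by case: y => //= y; rewrite anchor_idem eqxx.
  congr (_ + _); first by rewrite !raddfB !Qfl.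
  rewrite -[RHS]/((Q \o tl) _) [RHS]raddfMz; congr (_ *~ _).
  rewrite -(altsum_tors_gen nG bG) /tors_coef altsum_raddf.
  apply: eq_altsum_size => y r; rewrite wn => -[rm]; apply/esym.
  apply: (label_gen_ext (T := Q \o tl)) => //.
  - exact: tors_gen_degen.
  - case: y => [y|]; last exact: tors_gen_None.
    rewrite negbK => /codomP[x' ->]; exact: tors_gen_f.
- move=> t; apply/Q0.
  rewrite raddfMz.
  have Qtl0 p : Q (tl (gen p)) *~ l = 0.
    by rewrite -pmulrn Qtl; apply: tors_gen_torsion.
  rewrite [t]freeabE -[Q _]/((Q \o tl) _) raddf_sum mulrz_suml big1 // => p _.
  by rewrite raddfMz mulrzAC Qtl0 mul0rz.
- have [/eqP X00|/cycle_gcd_gt0->//] := posnP #|X0|.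
  apply/orP; right; rewrite -leqn0 card_prod.
  have -> : #|{: initial}| = 0%N.
    by apply/eqP; rewrite -leqn0 -(eqP X00) card_sig max_card.
  by [].
Qed.
End PositiveDegree.
End FSpindleSplit.

Section DegreeZero.
Variables (X0 : finType) (f : X0 -> X0).
Local Notation X := (option X0).
Local Notation op := (fspindle_op f).
Local Notation S := (fspindle f).

Definition vertex_gen (y : X) : freeab (option (component f)) :=
  [ffun p => (omap val p == omap (anchor f) y)%:R].

Definition vertex_cocycle (s : seq X) : freeab (option (component f)) :=
  if s is [:: y] then vertex_gen y else 0.

Lemma vertex_gen_gen p : vertex_gen (omap val p) = gen p.
Proof.
apply/ffunP=> q; rewrite !ffunE; congr ((_ : bool)%:R).
case: p q => [p|] [q|] //=.
by rewrite (eqP (valP p)) -[RHS]val_eqE.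
Qed.

Lemma vertex_cocycleP : cocycle op vertex_cocycle.
Proof.
split=> [[|x [|y s]] //|].
case=> [|x [|y [|z s]]] //=; rewrite ?subr0 //.
  by case: x y => [x|] [y|]; rewrite /= /vertex_gen /= ?anchor_f subrr.
by rewrite altsum0 ?subr0.
Qed.

(** In degree [0] the relations identify [x] with [f x], so there is one
    generator for each component and one for the basepoint. *)
Lemma fspindle_split_zero l :
  inhabited
    (coker_split (normalized_boundary S 0) (option (component f)) void l).
Proof.
have [h hf hc] := height_exists f.
have [fc [fcE fcd]] : exists fc :
      {additive normalized_chain X 0 -> freeab (option (component f))},
    (forall s, size s = 1%N -> fc (nbasis 0 s) = vertex_cocycle s) /\
    forall a, fc (normalized_boundary S 0 a) = 0.
  exists (cochain vertex_cocycleP.1 0); split; first exact: cochain_nbasis.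
  exact: (cochain_boundary (S := S) _ vertex_cocycleP.2).
have [fl flE] : exists fl :
      {additive freeab (option (component f)) -> normalized_chain X 0},
    forall p, fl (gen p) = nbasis 0 [:: omap val p].
  exists (extend (fun p => nbasis 0 [:: omap val p])) => p.
  exact: extend_gen.
have [QT [Q Q0]] :
    exists (QT : zmodType) (Q : {additive normalized_chain X 0 -> QT}),
    forall z, Q z = 0 <-> exists a, normalized_boundary S 0 a = z.
  by exists _, (coker_proj (normalized_boundary S 0)); exact: coker_proj_eq0.
have [nG bG] : cocycle op (fun s => Q (nbasis 0 s)).
  by apply: (@cocycle_of_nbasis _ S) => a; apply/Q0; exists a.
constructor.
apply: (@CokerSplit _ _ _ _ _ _ fc (\0 : {additive _ -> freeab void}) fl
          (\0 : {additive freeab void -> _})) => //.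
- by move=> a; rewrite raddf0.
- move=> u; apply/eqP; rewrite -subr_eq0; apply/eqP.
  apply: (@freeab_hom_eq0 _ _ ((fc \o fl) \- idfun)) => p /=.
  by rewrite flE fcE //= vertex_gen_gen subrr.
- by move=> t; rewrite raddf0.
- by move=> t; apply/ffunP; case.
- move=> z; apply/Q0; rewrite subr0 raddfB.
  apply/eqP; rewrite subr_eq0; apply/eqP.
  move: z; apply: (@nchain_ext _ _ _ Q (Q \o fl \o fc)) => -[|x [|y s]] //= _.
  rewrite fcE //=.
  case: x => [x|]; last by rewrite [vertex_gen _](vertex_gen_gen None) flE.
  pose c : component f := exist (fun y => anchor f y == y) (anchor f x)
    (introT eqP (anchor_idem f x)).
  have -> : vertex_gen (Some x) = gen (Some c).
    by rewrite -vertex_gen_gen /vertex_gen /= anchor_idem.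
  rewrite flE /=.
  have step y : Q (nbasis 0 [:: Some (f y)]) = Q (nbasis 0 [:: Some y]) + 0.
    have /= := bG [:: None; Some y].
    by rewrite subr0 => /eqP; rewrite subr_eq0 addr0 => /eqP ->.
  have := affine_on_component (G := fun y => Q (nbasis 0 [:: Some y]))
    hf hc step _ x.
  by rewrite mul0rn mul0rz addr0; apply.
- by move=> t; exists 0; rewrite raddf0 mul0rz.
- by rewrite card_void eqxx orbT.
Qed.

(** The augmentation is onto, so its cokernel is zero. *)
Lemma augmentation_split : inhabited (coker_split (augmentation X) void void 0).
Proof.
constructor.
apply: (@CokerSplit _ _ _ _ _ _ (\0 : {additive _ -> freeab void})
  (\0 : {additive _ -> freeab void}) (\0 : {additive freeab void -> _})
  (\0 : {additive freeab void -> _})) => //.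
- by move=> a; rewrite raddf0.
- by move=> u; apply/ffunP; case.
- by move=> t; apply/ffunP; case.
- move=> z; exists (nbasis 0 [:: None] *~ z); rewrite !subr0 raddfMz.
  have -> : augmentation X (nbasis 0 [:: None]) = 1; last by rewrite intz.
  rewrite -[ [:: None] ]/(tval [tuple None]) /nbasis word_gen_tuple.
  exact: etrans (augmentationE _) (extend_gen _ _).
- by move=> t; exists 0; rewrite raddf0 mul0rz.
- by rewrite card_void.
Qed.
End DegreeZero.

(** * Power groups and the number of words *)

Section Isomorphisms.
Lemma zmod_iso_of (G H : zmodType) (g : G -> H) :
  zmod_morphism g -> bijective g -> G ≅ H.
Proof.
move=> gB gbij; pose gA : {additive G -> H} :=
  HB.pack g (GRing.isZmodMorphism.Build _ _ g gB).
by exists gA.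
Qed.

Lemma zmod_iso_refl (G : zmodType) : G ≅ G.
Proof. by exists idfun; exists idfun. Qed.

Lemma zmod_iso_sym (G H : zmodType) : G ≅ H -> H ≅ G.
Proof.
case=> g [g' gK g'K]; apply: (@zmod_iso_of _ _ g'); last by exists g.
by move=> x y; apply: (can_inj gK); rewrite raddfB !g'K.
Qed.

Lemma zmod_iso_trans (H G K : zmodType) : G ≅ H -> H ≅ K -> G ≅ K.
Proof.
case=> g gbij [h hbij]; exists (h \o g); exact: bij_comp.
Qed.

Lemma prod_iso (G G' H H' : zmodType) :
  G ≅ G' -> H ≅ H' -> (G * H)%type ≅ (G' * H')%type.
Proof.
case=> g [g' gK g'K] [h [h' hK h'K]].
apply: (@zmod_iso_of _ _ (fun x => (g x.1, h x.2))).
  by move=> x y; rewrite !raddfB.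
by exists (fun x => (g' x.1, h' x.2)) => -[x y] /=; rewrite ?gK ?hK ?g'K ?h'K.
Qed.

Lemma ffun_iso (I : finType) (G H : zmodType) :
  G ≅ H -> {ffun I -> G} ≅ {ffun I -> H}.
Proof.
case=> g [g' gK g'K].
apply: (@zmod_iso_of _ _
  (fun u : {ffun I -> G} => [ffun i => g (u i)] : {ffun I -> H})).
  by move=> u v; apply/ffunP=> i; rewrite !ffunE raddfB.
exists (fun u : {ffun I -> H} => [ffun i => g' (u i)]) => u; apply/ffunP=> i;
  by rewrite !ffunE ?gK ?g'K.
Qed.

Lemma ffun_reindex_iso (S T : finType) (V : zmodType) :
  #|S| = #|T| -> {ffun S -> V} ≅ {ffun T -> V}.
Proof.
move=> ST.
pose a (t : T) : S := enum_val (cast_ord (esym ST) (enum_rank t)).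
pose b (s : S) : T := enum_val (cast_ord ST (enum_rank s)).
have ab : cancel a b by move=> t; rewrite /a /b enum_valK cast_ordKV enum_rankK.
have ba : cancel b a by move=> t; rewrite /a /b enum_valK cast_ordK enum_rankK.
apply: (@zmod_iso_of _ _
  (fun u : {ffun S -> V} => [ffun t => u (a t)] : {ffun T -> V})).
  by move=> u v; apply/ffunP=> i; rewrite !ffunE.
exists (fun u : {ffun T -> V} => [ffun s => u (b s)]) => u; apply/ffunP=> i;
  by rewrite !ffunE ?ab ?ba.
Qed.

Lemma ffun_curry_iso (S T : finType) (V : zmodType) :
  {ffun S -> {ffun T -> V}} ≅ {ffun S * T -> V}.
Proof.
apply: (@zmod_iso_of _ _ (fun u : {ffun S -> {ffun T -> V}} =>
    [ffun p => u p.1 p.2] : {ffun S * T -> V})).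
  by move=> u v; apply/ffunP=> i; rewrite !ffunE.
exists (fun u : {ffun S * T -> V} => [ffun s => [ffun t => u (s, t)]]) => u.
  by apply/ffunP=> s; apply/ffunP=> t; rewrite !ffunE.
by apply/ffunP=> -[s t]; rewrite !ffunE.
Qed.

Lemma ffun_prod_iso (S : finType) (G H : zmodType) :
  {ffun S -> (G * H)%type} ≅ ({ffun S -> G} * {ffun S -> H})%type.
Proof.
apply: (@zmod_iso_of _ _ (fun u : {ffun S -> (G * H)%type} =>
   ([ffun s => (u s).1], [ffun s => (u s).2]))).
  by move=> u v; congr (_, _); apply/ffunP=> i; rewrite !ffunE.
exists (fun p : {ffun S -> G} * {ffun S -> H} =>
  [ffun s => (p.1 s, p.2 s)]) => u.
  by apply/ffunP=> s; rewrite !ffunE -surjective_pairing.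
by case: u => u v; congr (_, _); apply/ffunP=> s; rewrite !ffunE.
Qed.

Lemma power_power_iso (G : zmodType) (a b c : nat) :
  c = (a * b)%N -> (G ^ c)%type ≅ ((G ^ a) ^ b)%type.
Proof.
move=> ->; apply/zmod_iso_sym/(zmod_iso_trans (ffun_curry_iso _ _ _)).
by apply: ffun_reindex_iso; rewrite card_prod !card_ord mulnC.
Qed.

Lemma prod_power_iso (G H : zmodType) (a b a' b' c : nat) :
  a' = (a * c)%N -> b' = (b * c)%N ->
  (G ^ a' * H ^ b')%type ≅ ((G ^ a * H ^ b) ^ c)%type.
Proof.
move=> aE bE; apply: (zmod_iso_trans _ (zmod_iso_sym (ffun_prod_iso _ _ _))).
by apply: prod_iso; exact: power_power_iso.
Qed.

Lemma prod_trivial_iso (G H : zmodType) (J : finType) :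
  #|J| = 0%N -> (G * {ffun J -> H})%type ≅ G.
Proof.
move=> J0; apply: (@zmod_iso_of _ _ fst); first by [].
exists (fun x => (x, 0)) => // -[x u] /=; congr (_, _).
by apply/ffunP=> j; have := card0_eq J0 j.
Qed.
End Isomorphisms.

Section CountWords.
Variable X : finType.

Lemma big_tuple_cons m (P : pred (seq X)) :
  #|[pred t : m.+1.-tuple X | P t]| =
  (\sum_x #|[pred t : m.-tuple X | P (x :: t)]|)%N.
Proof.
transitivity (\sum_(x : X) \sum_(t : m.-tuple X | P (x :: t)) 1)%N; last first.
  by apply: eq_bigr => x _; rewrite sum1_card.
rewrite -sum1_card pair_big_dep /=.
rewrite (reindex (fun p : X * m.-tuple X => [tuple of p.1 :: p.2])) /=.
  by apply: eq_bigl => -[x t].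
exists (fun t => (thead t, [tuple of behead t])) => [[x t] _|t _] /=.
  by rewrite theadE; congr (_, _); apply: val_inj.
by rewrite -tuple_eta.
Qed.

(** Each letter avoids the one before it. *)
Lemma card_nondeg_cons m x :
  #|[pred t : m.-tuple X | nondeg (x :: t)]| = (#|X|.-1 ^ m)%N.
Proof.
elim: m x => [|m IH] x.
  by rewrite (eq_card (B := predT)) ?card_tuple // => t; rewrite !inE tuple0.
rewrite (big_tuple_cons m (fun s => nondeg (x :: s))) (bigD1 x) //=.
rewrite [X in (X + _)%N]eq_card0 => [|t]; last by rewrite !inE eqxx.
rewrite add0n expnS -[X in (X * _)%N](cardC1 x) -sum_nat_const.
apply: eq_big => y; first by rewrite !inE.
move=> yx; rewrite -(IH y); apply: eq_card => t.
by rewrite /in_mem /= eq_sym yx.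
Qed.

Lemma card_word m : #|{: word X m.+1}| = (#|X| * #|X|.-1 ^ m)%N.
Proof.
rewrite card_sig big_tuple_cons (eq_bigr _ (fun x _ => card_nondeg_cons m x)).
by rewrite sum_nat_const.
Qed.

Lemma card_word0 : #|{: word X 0}| = 1%N.
Proof.
rewrite card_sig (eq_card (B := predT)) ?card_tuple // => t.
by rewrite !inE tuple0.
Qed.
End CountWords.

(** * Homology of an f-spindle *)

Section Homology.
Variables (X0 : finType) (f : X0 -> X0).
Local Notation X := (option X0).
Local Notation l := (cycle_gcd f).
Local Notation M := #|X0|.
Local Notation N := #|{: X}|.

Lemma card_component : #|{: component f}| = orb f.
Proof.
rewrite card_sig /orb /n_comp_mem; apply: eq_card => x.
by rewrite !inE andbT.
Qed.

Lemma card_initial : #|{: initial f}| = init f.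
Proof. exact: card_sig. Qed.

Lemma card_word_option m : #|{: word X m.+1}| = (M.+1 * M ^ m)%N.
Proof. by rewrite card_word card_option. Qed.

Lemma reduced_homology0 :
  reduced_normalized_homology (fspindle f) 0 ≅ (int ^ orb f)%type.
Proof.
have [S1] := fspindle_split_zero f 0; have [S0] := augmentation_split X0.
pose chi : {additive int -> freeab unit} := intmul (gen tt).
pose chi' : {additive freeab unit -> int} := extend (fun=> 1).
have chiK : cancel chi chi'.
  by move=> z; rewrite /chi [LHS]raddfMz /chi' /= extend_gen intz.
have chi'K : cancel chi' chi.
  move=> c; rewrite [c]freeabE (big_pred1 tt); last by case.
  by rewrite [chi' _]raddfMz /chi' /= extend_gen intz.
have d0d1 := augmentation_boundary (fspindle f).
apply: (zmod_iso_trans (homology_split (r := orb f) S1 S0 d0d1 chiK chi'K _)).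
  by rewrite card_unit card_void card_option card_component addn0 addn1.
exact/prod_trivial_iso/card_void.
Qed.

(** Reduces the homology in degree [m + 1] to the cokernel [S0] one degree
    below; the hypothesis on [r] is the rank count of [homology_split]. *)
Lemma normalized_homology_pos m r I' J' l'
    (S0 : coker_split (normalized_boundary (fspindle f) m) I' J' l') :
  (r + M.+1 * M ^ m = orb f * (M.+1 * M ^ m) + #|I'|)%N ->
  normalized_homology (fspindle f) m.+1 ≅
    (int ^ r * Zmod l ^ (init f * #|{: word X m}|))%type.
Proof.
move=> rE; have [h hf hc] := height_exists f.
have [S1] := fspindle_split_pos m hf hc.
have [chi [chi' [chiK chi'K]]] := normalized_chain_free X m.
have dd := @normalized_boundary_boundary _ (fspindle f) m.
apply: (zmod_iso_trans (homology_split (r := r) S1 S0 dd chiK chi'K _)).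
  by rewrite card_prod card_component card_word_option.
apply: prod_iso; first exact: zmod_iso_refl.
by apply: ffun_reindex_iso; rewrite card_prod card_initial card_ord.
Qed.

Lemma normalized_homology1 r :
  r%:Z = ((orb f)%:Z - 1) * M%:Z + 2 * (orb f)%:Z ->
  normalized_homology (fspindle f) 1 ≅ (int ^ r * Zmod l ^ init f)%type.
Proof.
move=> rE; have [S0] := fspindle_split_zero f 0.
have := normalized_homology_pos (r := r) S0; rewrite card_word0 muln1; apply.
by rewrite card_option card_component expn0; lia.
Qed.

Lemma normalized_homology_ge2 r n :
  r%:Z = ((orb f)%:Z - 1) * N%:Z ^+ 2 + N%:Z -> (2 <= n)%N ->
  normalized_homology (fspindle f) n ≅
    ((int ^ r * Zmod l ^ (init f * N)) ^ ((N - 1) ^ (n - 2)))%type.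
Proof.
move=> rE; case: n => [|[|m]] // _; rewrite subSS subSS subn0.
have [h hf hc] := height_exists f; have [S0] := fspindle_split_pos m hf hc.
have RE : (r + N * M = orb f * (N * N))%N.
  by move: rE; rewrite card_option expr2; nia.
have NM : (N - 1 = M)%N by rewrite card_option subn1.
rewrite NM.
apply: (zmod_iso_trans (normalized_homology_pos (r := r * M ^ m) S0 _)).
  rewrite card_prod card_component card_word_option -card_option expnS.
  by nia.
by apply: prod_power_iso => //; rewrite card_word_option -card_option mulnA.
Qed.
End Homology.

Theorem theorem4p3 (X0 : finType) (f : X0 -> X0) :
  let X := option X0 in
  let H := normalized_homology (fspindle f) in
  let l := cycle_gcd f in
  let r1 : int := ((orb f)%:Z - 1) * #|X0|%:Z + 2 * (orb f)%:Z in
  let r2 : int := ((orb f)%:Z - 1) * #|{: X}|%:Z ^+ 2 + #|{: X}|%:Z in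
  [/\ reduced_normalized_homology (fspindle f) 0 ≅ (int ^ orb f)%type,
      H 1%N ≅ (int ^ absz r1 * Zmod l ^ init f)%type,
      forall n : nat, (2 <= n)%N ->
        H n ≅ ((int ^ absz r2 * Zmod l ^ (init f * #|{: X}|))
               ^ ((#|{: X}| - 1) ^ (n - 2)))%type
    & forall n : nat, (2 <= n)%N -> H n.+1 ≅ (H n ^ (#|{: X}| - 1))%type].
Proof.
move=> X H l r1 r2; split.
- exact: reduced_homology0.
- exact: normalized_homology1 (gez0_abs (rank1_ge0 f)).
- by move=> n; apply: normalized_homology_ge2; exact: gez0_abs (rank2_ge0 f).
move=> n n2.
have H2 k := @normalized_homology_ge2 _ f _ k (gez0_abs (rank2_ge0 f)).
apply: (zmod_iso_trans (H2 n.+1 _)); first exact: ltnW.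
apply/zmod_iso_sym/(zmod_iso_trans (ffun_iso _ (H2 n n2))).
by apply/zmod_iso_sym/power_power_iso; rewrite subSn // expnSr.
Qed.
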